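(* Let $G$ be a countable, finitely generated amenable group, let $A$ be a finite set, let $\mathcal{F}$ be a strongly-stable class of shifts over $G$, and let $c\ge 0$. The isolated points in $\mathfrak{S}^{\mathcal{F}}_{\ge c}$ all have entropy $c$.
   Context: For a finite set $A$, $A^G$ carries the product topology ($A$ discrete), and $G$ acts on it by $[gx](h)=x(g^{-1}h)$. A shift is a closed $G$-invariant subset $X\subseteq A^G$. For finite $K\subset G$, $x_K$ is the restriction of $x$ to $K$ and $X_K=\{x_K : x\in X\}$. The space $\mathfrak{S}$ of all shifts in $A^G$ has the Hausdorff topology, which is compact and Polish; $X^n\to X$ if and only if for every finite $K\subset G$ one has $X^n_K=X_K$ for all large enough $n$. Fix a left-invariant word metric $d$ on $G$, and let $B_r=\{g\in G: d(e,g)\le r\}$. For finite $F\subset G$ let $\partial_rF=\{g\in G: gB_r\cap F\ne\emptyset \text{ and } gB_r\cap(G\setminus F)\neq\emptyset\}$ and $\rho_r(F)=|\partial_rF|/|F|$. A sequence $(F_n)$ of finite subsets of $G$ is Følner if $\lim_n\rho_r(F_n)=0$ for every $r\in\mathbb{N}$. The entropy of a shift $X$ is $h(X)=\lim_{n\to\infty}\frac{1}{|F_n|}\log|X_{F_n}|$ for any Følner sequence $(F_n)$ (the limit exists and does not depend on the sequence). A shift $X$ is strongly irreducible if there is $r\in\mathbb{N}$ such that for all finite $K,H\subset G$ with $d(k,h)>r$ for all $k\in K$, $h\in H$, and all $x,y\in X$, there is $z\in X$ with $z_K=x_K$ and $z_H=y_H$. A factor of a shift $X$ is a shift (over any finite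 alphabet) that is the image of $X$ under a continuous $G$-equivariant map. The product of shifts $X\subseteq A^G$ and $Y\subseteq B^G$ is regarded as a shift over the alphabet $A\times B$. A class $\mathcal{F}$ of shifts over $G$ (over arbitrary finite alphabets) is strongly-stable if it is closed under taking factors and under taking products with strongly irreducible shifts. $\mathfrak{S}^{\mathcal{F}}_{\ge c}$ is the set of shifts $X\in\mathfrak{S}$ that belong to $\mathcal{F}$ and satisfy $h(X)\ge c$, with the subspace topology.
   Formalization: The group G is assumed infinite (''countable'' read as countably infinite); for finite G the claim fails, e.g. A^G with |A|=2, c=0 and all shifts is isolated with entropy log 2. *)

(* Defs.v *)
From HB Require Import structures.
From mathcomp Require Import all_boot all_order all_algebra.
From mathcomp Require Import finmap.
From mathcomp Require Import all_classical all_reals all_analysis.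

Set Implicit Arguments.
Unset Strict Implicit.
Unset Printing Implicit Defensive.

Import Order.TTheory GRing.Theory Num.Theory.
Import numFieldNormedType.Exports.

Local Open Scope classical_set_scope.
Local Open Scope ring_scope.

Section word_metric.
Variables (G : groupType) (S : {fset G}).

Definition word (n : nat) (g : G) : Prop :=
  exists s : seq G, [/\ size s = n,
    forall x, x \in s -> (x \in S) || (x^-1%g \in S) &
    g = foldr (fun x y => (x * y)%g) 1%g s].

Definition generating : Prop := forall g, exists n, word n g.

(* The least n with [word n g]; meaningful when [S] is generating. *)
Definition word_length (g : G) : nat :=
  get [set n | word n g /\ forall m, word m g -> (n <= m)%N].

Definition word_dist (g h : G) : nat := word_length (g^-1 * h)%g.

Definition word_ball (r : nat) : set G := [set g | (word_dist 1%g g <= r)%N].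

Definition boundary (r : nat) (F : {fset G}) : set G :=
  [set g | ([set (g * b)%g | b in word_ball r] `&` [set` F]) !=set0 /\
           ([set (g * b)%g | b in word_ball r] `&` ~` [set` F]) !=set0].

Lemma word_lengthP g : generating ->
  word (word_length g) g /\ forall m, word m g -> (word_length g <= m)%N.
Proof.
move=> gen; suff : exists n, [set n | word n g /\
    forall m, word m g -> (n <= m)%N] n by move/getPex.
have ex : exists n, `[< word n g >].
  by have [n wn] := gen g; exists n; apply/asboolP.
exists (ex_minn ex); case: ex_minnP => n /asboolP wn minn; split=> // m wm.
by apply: minn; apply/asboolP.
Qed.

Lemma word_dist_left k g h : word_dist (k * g)%g (k * h)%g = word_dist g h.
Proof. by rewrite /word_dist invgM -mulgA mulKg. Qed.

Lemma finite_word n : finite_set (word n).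
Proof.
elim: n => [|n IHn].
  apply: (@sub_finite_set _ _ [set 1%g]); last exact: finite_set1.
  by move=> g [s [/size0nil -> _ ->]].
pose T := [set` S] `|` [set x^-1%g | x in [set` S]].
apply: (@sub_finite_set _ _ [set (x * y)%g | x in T & y in word n]).
  move=> g [[|x s] [//= [sn] sS ->]]; exists x.
    have := sS x (mem_head _ _); case/orP => xS; [by left|right].
    by exists x^-1%g => //; rewrite invgK.
  exists (foldr (fun x y => (x * y)%g) 1%g s) => //.
  by exists s; split=> // y ys; apply: sS; rewrite inE ys orbT.
apply: finite_image2 => //; rewrite finite_setU; split.
  exact: finite_fset.
by apply: finite_image; exact: finite_fset.
Qed.

Lemma finite_word_ball r : generating -> finite_set (word_ball r).
Proof.
move=> gen; apply: (@sub_finite_set _ _ (\bigcup_(n in `I_r.+1) word n)).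
  move=> g; rewrite /word_ball /word_dist /= invg1 mul1g => gr.
  by exists (word_length g) => //; have [] := word_lengthP g gen.
by apply: bigcup_finite => *; [exact: finite_II|exact: finite_word].
Qed.

Lemma finite_boundary r F : generating -> finite_set (boundary r F).
Proof.
move=> gen; apply: (@sub_finite_set _ _
    [set (f * b^-1)%g | f in [set` F] & b in word_ball r]).
  move=> g [[f [[b br <-] gbF]] _]; exists (g * b)%g => //.
  by exists b => //; rewrite mulgK.
apply: finite_image2; [exact: finite_fset|exact: finite_word_ball].
Qed.

End word_metric.

Section folner.
Variables (R : realType) (G : groupType) (S : {fset G}).

(* [fset_set] is faithful here by [finite_boundary]. *)
Definition boundary_ratio (r : nat) (F : {fset G}) : R :=
  #|` fset_set (boundary S r F)|%:R / #|` F|%:R.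

(* Nonemptiness is needed because 0 / 0 = 0 in R. *)
Definition folner (F : nat -> {fset G}) : Prop :=
  (forall n, F n != fset0) /\
  forall r, boundary_ratio r (F n) @[n --> \oo] --> (0 : R).

Definition amenable : Prop := exists F, folner F.

End folner.

Notation config G A := {ptws G -> discrete_topology A}.

Definition gact (G : groupType) (A : finType) (g : G) (x : config G A) :
  config G A := fun h => x (g^-1 * h)%g.

Record subshift (G : groupType) (A : finType) := Shift {
  shift_set :> set (config G A);
  shift_closed : closed shift_set;
  shift_invariant : forall g x, shift_set x -> shift_set (gact g x)
}.

Lemma shift_eq (G : groupType) (A : finType) (X Y : subshift G A) :
  shift_set X = shift_set Y -> X = Y.
Proof.
case: X Y => [X cX iX] [Y cY iY] /= XY; subst Y.
by congr Shift; exact: Prop_irrelevance.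
Qed.

Definition restr (G : groupType) (A : finType) (K : {fset G})
  (x : config G A) : {ffun K -> A} := [ffun k => x (val k)].

Definition patterns (G : groupType) (A : finType) (X : set (config G A))
  (K : {fset G}) : set {ffun K -> A} := restr K @` X.
Arguments patterns {G A} X K.

Section config_uniformity.
Variables (G : groupType) (A : finType).

Lemma restrP (K : {fset G}) (x y : config G A) :
  restr K x = restr K y <-> forall k, k \in K -> x k = y k.
Proof.
split=> [xy k kK|xy]; last by apply/ffunP => k; rewrite !ffunE xy// fsvalP.
by have := congr1 (fun f : {ffun K -> A} => f [` kK]%fset) xy; rewrite !ffunE.
Qed.

Lemma fset_cover (T U : choiceType) (F : {fset T}) (f : T -> U) :
  exists K : {fset U}, forall t, t \in F -> f t \in K.
Proof. by exists [fset f t | t in F]%fset => t tF; apply/imfsetP; exists t. Qed.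

Lemma config_entourageP (E : set (config G A * config G A)) :
  entourage E <->
  exists K : {fset G}, forall x y, restr K x = restr K y -> E (x, y).
Proof.
split=> [[D [F _ <-] DE]|[K KE]].
  have [K KF] := fset_cover F (fun p => (sval p).1 : G).
  exists K => x y /restrP xy.
  apply: DE => -[[i V] iV] pF; have /asboolP[W eW WV] := iV; apply: WV => /=.
  change (W (x i, y i)); rewrite xy; first exact: entourage_refl.
  exact: (KF _ pF).
have eK k : entourage [set xy : config G A * config G A | xy.1 k = xy.2 k].
  pose V := [set xy : config G A * config G A | xy.1 k = xy.2 k].
  have iV : `[< @entourage (initial_topology
      (@proj _ (fun=> discrete_topology A) k)) V >].
    apply/asboolP; exists [set ab | ab.1 = ab.2] => //.
    by rewrite uniform_discrete => _ [a _ <-].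
  exists V => //.
  exists [fset (exist _ ((k : {classic G}), V) iV)]%fset.
    by move=> *; exact: in_setT.
  rewrite set_fset1 bigcap_set1//.
have : entourage (\bigcap_(k in [set` K])
    [set xy : config G A * config G A | xy.1 k = xy.2 k]).
  by apply: filter_bigI => k _; exact: eK.
by apply: filterS => -[x y] xy; apply/KE/restrP => k kK; exact: (xy k kK).
Qed.

Lemma config_nbhsP (x : config G A) (W : set (config G A)) :
  nbhs x W <->
  exists K : {fset G}, forall y, restr K x = restr K y -> W y.
Proof.
split=> [/nbhsP[E /config_entourageP[K KE] EW]|[K KW]].
  by exists K => y xy; apply: EW; apply/mem_set; exact: KE.
apply/nbhsP; exists [set yz | restr K yz.1 = restr K yz.2].
  by apply/config_entourageP; exists K.
by move=> y /xsectionP; exact: KW.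
Qed.

End config_uniformity.

Section hausdorff.
Variables (G : groupType) (A : finType).
Local Notation subshift := (subshift G A).

HB.instance Definition _ := gen_eqMixin subshift.
HB.instance Definition _ := gen_choiceMixin subshift.

(* For a metric d and E = {d < e}, this says that X lies in the
   e-neighbourhood of Y and Y in the e-neighbourhood of X. *)
Definition hausdorff_close (E : set (config G A * config G A)) :
    set (subshift * subshift) :=
  [set XY : subshift * subshift |
    (forall x, shift_set XY.1 x -> exists2 y, shift_set XY.2 y & E (x, y)) /\
    (forall y, shift_set XY.2 y -> exists2 x, shift_set XY.1 x & E (x, y))].

(* The uniformity of the Hausdorff distance, for any metric compatible with
   the topology of the compact space [config G A]. *)
Definition hausdorff_entourage : set_system (subshift * subshift) :=
  filter_from (@entourage (config G A)) hausdorff_close.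

Lemma hausdorff_entourage_filter : Filter hausdorff_entourage.
Proof.
apply: filter_from_filter; first by exists setT; exact: entourageT.
move=> E F eE eF; exists (E `&` F); first exact: filterI.
move=> [X Y] [XY YX]; split; split=> x xX.
- by have [y ? []] := XY x xX; exists y.
- by have [y ? []] := YX x xX; exists y.
- by have [y ? []] := XY x xX; exists y.
- by have [y ? []] := YX x xX; exists y.
Qed.

Lemma hausdorff_entourage_diagonal W :
  hausdorff_entourage W -> (diagonal `<=` W)%relation.
Proof.
move=> [E eE EW] [X Y] /= /diagonalP <-; apply: EW.
by split=> x xX; exists x => //; exact: entourage_refl.
Qed.

Lemma hausdorff_entourage_inv W :
  hausdorff_entourage W -> hausdorff_entourage (W^-1)%relation.
Proof.
move=> [E eE EW]; exists (E^-1)%relation; first exact: entourage_inv.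
by move=> [X Y] [XY YX]; apply: EW; split.
Qed.

Lemma hausdorff_entourage_split W : hausdorff_entourage W ->
  exists2 V, hausdorff_entourage V & (V \; V `<=` W)%relation.
Proof.
move=> [E eE EW]; exists (hausdorff_close (split_ent E)).
  by exists (split_ent E) => //; exact: entourage_split_ent.
move=> [X Z] [Y [XY YX] [YZ ZY]]; apply: EW; split=> [x xX|z zZ] /=.
  have [y yY xy] := XY x xX; have [z zZ yz] := YZ y yY.
  by exists z => //; apply: entourage_split xy yz.
have [y yY yz] := ZY z zZ; have [x xX xy] := YX y yY.
by exists x => //; apply: entourage_split xy yz.
Qed.

HB.instance Definition _ := isUniform.Build subshift
  hausdorff_entourage_filter hausdorff_entourage_diagonal
  hausdorff_entourage_inv hausdorff_entourage_split.

Lemma shift_nbhsP (X : subshift) (W : set subshift) :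
  nbhs X W <->
  exists K : {fset G}, forall Y : subshift, patterns X K = patterns Y K -> W Y.
Proof.
split=> [/nbhsP[V [E /config_entourageP[K KE] EV] VW]|[K KW]].
  exists K => Y XY; apply: VW; apply/mem_set/EV; split=> [x xX|y yY] /=.
    have : patterns Y K (restr K x) by rewrite -XY; exists x.
    by move=> [y yY xy]; exists y => //; exact: KE.
  have : patterns X K (restr K y) by rewrite XY; exists y.
  by move=> [x xX xy]; exists x => //; exact: KE.
apply/nbhsP; exists (hausdorff_close [set xy | restr K xy.1 = restr K xy.2]).
  exists [set xy | restr K xy.1 = restr K xy.2] => //.
  by apply/config_entourageP; exists K.
move=> Y /xsectionP [XY YX]; apply: KW; apply/seteqP; split=> p /= [x xX <-].
  by have [y yY xy] := XY x xX; exists y.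
by have [y yY xy] := YX x xX; exists y.
Qed.

Lemma shift_cvgP (X : nat -> subshift) (Y : subshift) :
  X n @[n --> \oo] --> Y <->
  forall K : {fset G}, \forall n \near \oo, patterns (X n) K = patterns Y K.
Proof.
split=> [XY K|XY W /shift_nbhsP[K KW]].
  have : nbhs Y [set Z : subshift | patterns Z K = patterns Y K].
    by apply/shift_nbhsP; exists K.
  by move/XY.
suff : \forall n \near \oo, W (X n) by [].
by apply: filterS (XY K) => n XnY; exact: KW.
Qed.

End hausdorff.

Section products.
Variables (G : groupType) (A B : finType).

Definition prod_set (X : set (config G A)) (Y : set (config G B)) :
    set (config G (A * B)%type) :=
  [set z | X (fun g => (z g).1) /\ Y (fun g => (z g).2)].

Lemma continuous_letterwise (C D : finType) (f : C -> D) :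
  continuous (fun z : config G C => (fun g => f (z g)) : config G D).
Proof.
move=> z W /config_nbhsP[K KW]; apply/config_nbhsP; exists K => y /restrP zy.
by apply: KW; apply/restrP => k kK; rewrite zy.
Qed.

Lemma prod_set_closed (X : subshift G A) (Y : subshift G B) : closed (prod_set X Y).
Proof.
apply: closedI.
  apply: (@preimage_closed _ _
    (fun z : config G (A * B)%type => (fun g => (z g).1) : config G A) X).
    by move=> *; exact: continuous_letterwise.
  exact: (@shift_closed _ _ X).
apply: (@preimage_closed _ _
  (fun z : config G (A * B)%type => (fun g => (z g).2) : config G B) Y).
  by move=> *; exact: continuous_letterwise.
exact: (@shift_closed _ _ Y).
Qed.

Lemma prod_set_invariant (X : subshift G A) (Y : subshift G B) g z :
  prod_set X Y z -> prod_set X Y (gact g z).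
Proof.
by move=> [Xz Yz]; split; [exact: (shift_invariant g Xz)|
  exact: (shift_invariant g Yz)].
Qed.

Definition prod_shift (X : subshift G A) (Y : subshift G B) : subshift G (A * B)%type :=
  Shift (@prod_set_closed X Y) (@prod_set_invariant X Y).

Definition is_factor (X : subshift G A) (Y : subshift G B) : Prop :=
  exists phi : config G A -> config G B,
    [/\ {within (X : set (config G A)), continuous phi},
        forall g x, shift_set X x -> phi (gact g x) = gact g (phi x) &
        phi @` X = Y].

End products.

Section entropy.
Variables (R : realType) (G : groupType) (S : {fset G}) (A : finType).
Local Open Scope ereal_scope.

(* [lne] is the logarithm with [lne 0 = -oo], so the empty shift has
   entropy -oo. *)
Definition pattern_entropy (X : subshift G A) (F : {fset G}) : \bar R :=
  ((#|` F|%:R)^-1)%:E * lne (#|` fset_set (patterns X F)|%:R)%:E.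

(* The common limit along all Folner sequences. *)
Definition entropy (X : subshift G A) : \bar R :=
  get [set l | forall F, folner R S F ->
    pattern_entropy X (F n) @[n --> \oo] --> l].

End entropy.

Definition strongly_irreducible (G : groupType) (S : {fset G}) (A : finType)
    (X : subshift G A) : Prop :=
  exists r : nat, forall K H : {fset G},
    (forall k h, k \in K -> h \in H -> (r < word_dist S k h)%N) ->
    forall x y, shift_set X x -> shift_set X y ->
      exists z, [/\ shift_set X z, restr K z = restr K x & restr H z = restr H y].

Definition shift_class (G : groupType) := forall A : finType, set (subshift G A).

Definition strongly_stable (G : groupType) (S : {fset G})
    (F : shift_class G) : Prop :=
  (forall (A B : finType) (X : subshift G A) (Y : subshift G B),
     F A X -> is_factor X Y -> F B Y) /\
  (forall (A B : finType) (X : subshift G A) (Y : subshift G B),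
     F A X -> strongly_irreducible S Y -> F (A * B)%type (prod_shift X Y)).

Definition shifts_ge (R : realType) (G : groupType) (S : {fset G})
    (F : shift_class G) (A : finType) (c : R) : set (subshift G A) :=
  [set X | F A X /\ (c%:E <= entropy R S X)%E].
Arguments shifts_ge {R G} S F A c.

(* Main.v *)
(** Let X have entropy h > c and let K be a finite window.  A factor Z of the
    product of X with a strongly irreducible "marker" shift is built with the
    same K-patterns as X, with c <= h(Z), and with Z <> X; so X is not isolated.

    Shearer's inequality for the sizes of projections shows that the entropy is
    the infimum of log |X_L| / |L| over all finite L, along every Folner sequence,
    and that log |X_T| <= (|T| + |bd_L T|) log |X_L| / |L| for every finite T.

    Fix an almost invariant tile F and V = F t_1 u ... u F t_M with disjoint
    translates.  A marker configuration is a set C such that the tiles cV, c in C,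
    overlap little and every gV is covered by them in a fixed proportion; Zorn's
    lemma completes partial markings, hence strong irreducibility.  The tiles cF
    then cover a proportion of order 1/M of the group.  Z is obtained by erasing:
    on the part of cF which lies well inside cF and away from the other tiles,
    x is replaced by a canonical extension in X of its values on the rest of cF.

    Erasing costs at most O(log |A| / M) of entropy, and M > 3|K| leaves whole
    translates of K untouched.  Conversely a pattern of Z is determined by the
    markers, which are too sparse to carry much entropy, and by the pattern of X
    outside the erased region, to which the bound with bd_L applies.  If Z = X this
    bounds the entropy of X by a number smaller than h. *)

Require Import Defs.
From mathcomp Require Import all_boot all_order all_algebra finmap.
From mathcomp Require Import all_classical all_reals all_analysis.
From mathcomp Require Import ring lra zify.

Set Implicit Arguments.
Unset Strict Implicit.
Unset Printing Implicit Defensive.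

Import Order.TTheory GRing.Theory Num.Theory.
Import numFieldNormedType.Exports.

Local Open Scope classical_set_scope.
Local Open Scope ring_scope.

(** * Shearer's inequality for pattern counts *)

(** Hölder's inequality with a constant factor [Q] carried along. Dividing each [f i] by its sum
    lets the arithmetic-geometric mean inequality act pointwise, and the means add up to 1 over
    [a]. *)
Lemma holder_product (R : realType) (I J : finType) (B : {set I})
    (f : I -> J -> R) (N : J -> R) (Q : R) :
  (0 < #|B|)%N -> 0 <= Q -> (forall i a, 0 <= f i a) -> (forall a, 0 <= N a) ->
  (forall a, N a ^+ #|B| <= Q * \prod_(i in B) f i a) ->
  (\sum_a N a) ^+ #|B| <= Q * \prod_(i in B) \sum_a f i a.
Proof.
move=> k0 Q0 f0 N0 NB.
have S0 i : 0 <= \sum_a f i a by apply: sumr_ge0.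
(* A vanishing sum forces every [N a] to vanish; otherwise the normalisation may divide by the
   sums. *)
have [/existsP[i /andP[iB /eqP Si]]|/existsPn Spos] :=
    boolP [exists i, (i \in B) && (\sum_a f i a == 0)].
  have N00 a : N a = 0.
    have fi0 : f i a = 0.
      by move/eqP: Si; rewrite psumr_eq0// => /allP /(_ a (mem_index_enum a))
        /implyP /(_ isT) /eqP.
    have := NB a; rewrite (bigD1 i)//= fi0 mul0r mulr0 => Na.
    have : N a ^+ #|B| == 0 by rewrite eq_le Na exprn_ge0.
    by rewrite expf_eq0 k0 => /eqP.
  rewrite big1 => [|a _]; last exact: N00.
  by rewrite expr0n eqn0Ngt k0/= mulr_ge0// prodr_ge0.
have {}Spos i : i \in B -> 0 < \sum_a f i a.
  by move=> iB; rewrite lt_def S0 andbT; move: (Spos i); rewrite iB.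
pose Z := Q * \prod_(i in B) \sum_a f i a.
have Z0 : 0 <= Z by rewrite mulr_ge0// prodr_ge0.
pose q := Z `^ (#|B|%:R^-1).
have q0 : 0 <= q by exact: powR_ge0.
have kR : #|B|%:R != 0 :> R by rewrite pnatr_eq0 -lt0n.
have qk : q ^+ #|B| = Z.
  by rewrite -powR_mulrn// -powRrM mulVf// powRr1.
rewrite -/Z -qk.
have Nle a : N a <= q * ((\sum_(i in B) (f i a / \sum_b f i b)) / #|B|%:R).
  have r0 i : i \in B -> 0 <= f i a / \sum_b f i b by move=> _; rewrite divr_ge0.
  rewrite -(@ler_pXn2r _ #|B|) ?nnegrE//; last first.
    by rewrite mulr_ge0// divr_ge0 ?ler0n// sumr_ge0.
  rewrite exprMn qk.
  apply: (@le_trans _ _ (Z * \prod_(i in B) (f i a / \sum_b f i b))).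
    apply: le_trans (NB a) _; rewrite /Z -mulrA ler_wpM2l// -big_split/=.
    apply: ler_prod => i iB; rewrite f0/= mulrCA divff ?mulr1//.
    by rewrite gt_eqF// Spos.
  rewrite ler_wpM2l//.
  by have := @leif_AGM _ _ (mem B) (fun i => f i a / \sum_b f i b) r0; case.
apply: lerXn2r; rewrite ?nnegrE//; first exact: sumr_ge0.
apply: le_trans (ler_sum _ (fun a _ => Nle a)) _.
rewrite -mulr_sumr -mulr_suml exchange_big/=.
rewrite (eq_bigr (fun=> 1)) => [|i iB]; last first.
  by rewrite -mulr_suml divff// gt_eqF// Spos.
by rewrite sumr_const divff// mulr1.
Qed.

Section patterns.
Variables (G : groupType) (A : finType).
Implicit Types (X P : set (config G A)) (K T : {fset G}).

Definition npat X K := #|` fset_set (patterns X K)|.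

Lemma npatE X K : npat X K = #|[set p : {ffun K -> A} | `[< patterns X K p >]]%SET|.
Proof.
rewrite /npat -card_finset; congr #|` _|; apply/fsetP => p.
rewrite in_fset_set; last exact: finite_finset.
rewrite !inE; apply/idP/idP => [/set_mem|] H; last exact/mem_set/asboolP.
exact/asboolP.
Qed.

Lemma npat_cons P t T :
  (npat P (t |` T)%fset <= \sum_a npat [set x | P x /\ x t = a] T)%N.
Proof.
under eq_bigr do rewrite npatE -sum1_card.
rewrite npatE pair_big_dep/= sum1_card.
pose g (p : {ffun (t |` T)%fset -> A}) : A * {ffun T -> A} :=
  (p [` fset1U1 t T]%fset, [ffun k => p (fincl (fsubsetU1 t T) k)]).
have gi : injective g.
  move=> p q [pq1 /ffunP pq2]; apply/ffunP => -[k kT].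
  case/fset1UP: (kT) => [kt|kT'].
    by subst k; rewrite (bool_irrelevance kT (fset1U1 t T)).
  have := pq2 [` kT']%fset; rewrite !ffunE.
  rewrite (_ : fincl _ _ = [` kT]%fset)//; exact: val_inj.
rewrite -(card_imset _ gi); apply: subset_leq_card; apply/fintype.subsetP => y /imsetP[p].
rewrite inE => /asboolP[x Px <-] {y}->; rewrite unfold_in/=.
suff : (g (restr (t |` T)%fset x)).2 \in [set p | `[< patterns
    [set z | P z /\ z t = (g (restr (t |` T)%fset x)).1] T p >]]%SET by [].
rewrite inE.
apply/asboolP; exists x; first by split=> //; rewrite /g /= ffunE.
by apply/ffunP => k; rewrite !ffunE.
Qed.

Lemma npat_split P t K : t \in K ->
  (\sum_a npat [set x | P x /\ x t = a] K <= npat P K)%N.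
Proof.
move=> tK; rewrite npatE -sum1_card.
rewrite (partition_big (fun p : {ffun K -> A} => p [` tK]%fset) predT)//=.
apply: leq_sum => a _; rewrite npatE -sum1_card; apply: eq_leq.
apply: eq_bigl => p; rewrite !inE; apply/asboolP/andP => [[x [Px xt] <-]|].
  by split; [apply/asboolP; exists x|rewrite ffunE/= xt].
move=> [/asboolP[x Px <-]]; rewrite ffunE/= => /eqP xt.
by exists x.
Qed.

Lemma npatS P Q K : P `<=` Q -> (npat P K <= npat Q K)%N.
Proof.
move=> PQ; rewrite !npatE; apply: subset_leq_card; apply/fintype.subsetP => p.
by rewrite !inE => -[x Px xp]; exists x => //; exact: PQ.
Qed.

Lemma npat_gt0 P K : P !=set0 -> (0 < npat P K)%N.
Proof.
move=> [x Px]; rewrite npatE; apply/card_gt0P; exists (restr K x).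
by rewrite inE; apply/asboolP; exists x.
Qed.

Lemma npat_set0 K : npat set0 K = 0%N.
Proof. by rewrite npatE; apply: eq_card0 => p; rewrite inE; apply/asboolP => -[]. Qed.

(** Induction on [T], slicing [P] by the letter at a new point [t]. On the [k] windows containing
    [t], Hölder's inequality sums over the letter; on the others monotonicity suffices. [P] is an
    arbitrary set because slices of a shift are not invariant. *)
Lemma shearer (R : realType) (I : finType) (K : I -> {fset G}) (k : nat) P T :
  (0 < k)%N -> (forall t, t \in T -> #|[set i | t \in K i]%SET| = k) ->
  (npat P T)%:R ^+ k <= \prod_i (npat P (K i))%:R :> R.
Proof.
move=> k0; elim/fset1U_rect: T P => [|t T tT IH] P Tk.
  have [->|/set0P P0] := eqVneq P set0.
    by rewrite npat_set0 expr0n eqn0Ngt k0 prodr_ge0.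
  have -> : npat P fset0 = 1%N.
    apply/eqP; rewrite eqn_leq npat_gt0// andbT npatE.
    by apply: leq_trans (max_card _) _; rewrite card_ffun cardfT0.
  rewrite expr1n -natr_prod ler1n prodn_gt0// => i; exact: npat_gt0.
pose B := [set i | t \in K i]%SET.
have Bk : #|B| = k by apply: Tk; rewrite fset1U1.
pose Pa a : set (config G A) := [set x | P x /\ x t = a].
pose Q : R := \prod_(i | i \notin B) (npat P (K i))%:R.
rewrite (bigID (mem B))/= mulrC -/Q.
apply: (@le_trans _ _ (Q * \prod_(i in B) \sum_a (npat (Pa a) (K i))%:R)); last first.
  rewrite ler_wpM2l ?prodr_ge0//; apply: ler_prod => i.
  rewrite inE => iB; rewrite sumr_ge0//= -natr_sum ler_nat; exact: npat_split.
apply: (@le_trans _ _ ((\sum_a (npat (Pa a) T)%:R) ^+ k)).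
  by apply: lerXn2r; rewrite ?nnegrE ?sumr_ge0// -natr_sum ler_nat npat_cons.
rewrite -Bk; apply: holder_product => //; rewrite ?Bk//; first exact: prodr_ge0.
move=> a; apply: le_trans (IH _ _) _ => [u uT|]; first by apply: Tk; rewrite fset1Ur.
rewrite (bigID (mem B))/= mulrC ler_wpM2r ?prodr_ge0//.
apply: ler_prod => i _; rewrite ler0n ler_nat/=; apply: npatS => x; by case.
Qed.

End patterns.

(** * Products, translates and boundaries of finite sets *)

Section fset_products.
Variable G : groupType.
Implicit Types (D E K L Q T : {fset G}) (g h : G).
Local Open Scope fset_scope.

Definition lcos g Q : {fset G} := [fset (g * q)%g | q in Q].
Definition fmul D E : {fset G} := [fset (d * e)%g | d in D, e in E].
Definition fsinv D : {fset G} := [fset d^-1%g | d in D].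
(** [fmul T (fsinv Q)] holds the [g] with [g Q] meeting [T], so this is [boundary] with a finite set
    in place of a ball. *)
Definition fbd Q T : {fset G} :=
  [fset g in fmul T (fsinv Q) | ~~ (lcos g Q `<=` T)].

Lemma in_lcos g h Q : (h \in lcos g Q) = ((g^-1 * h)%g \in Q).
Proof.
apply/imfsetP/idP => [[q /= qQ ->]|gh]; first by rewrite mulKg.
by exists (g^-1 * h)%g => //; rewrite mulVKg.
Qed.

Lemma card_lcos g Q : #|` lcos g Q| = #|` Q|.
Proof. by apply: card_imfset => x y /mulgI. Qed.

Lemma in_fsinv D h : (h \in fsinv D) = ((h^-1)%g \in D).
Proof.
apply/imfsetP/idP => [[q /= qQ ->]|gh]; first by rewrite invgK.
by exists (h^-1)%g => //; rewrite invgK.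
Qed.

Lemma fmulP D E h :
  reflect (exists2 d, d \in D & (d^-1 * h)%g \in E) (h \in fmul D E).
Proof.
apply: (iffP (imfset2P _ _ _ _ _)) => [[d /= dD [e eE ->]]|[d dD eE]].
  by exists d => //; rewrite mulKg.
by exists d => //; exists (d^-1 * h)%g => //; rewrite mulVKg.
Qed.

Lemma mem_fmul D E d e : d \in D -> e \in E -> (d * e)%g \in fmul D E.
Proof. by move=> dD eE; apply/fmulP; exists d => //; rewrite mulKg. Qed.

Lemma fmul_fsetU1 d D E : fmul (d |` D) E = lcos d E `|` fmul D E.
Proof.
apply/fsetP => h; rewrite !inE in_lcos; apply/fmulP/orP.
  move=> [x /fset1UP[->|xD] xE]; first by left.
  by right; apply/fmulP; exists x.
move=> [dE|/fmulP[x xD xE]]; first by exists d; rewrite ?fset1U1.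
by exists x; rewrite ?fset1Ur.
Qed.

Lemma card_fmul D E : (#|` fmul D E| <= #|` D| * #|` E|)%N.
Proof.
elim/fset1U_rect: D => [|d D dD IH].
  rewrite (_ : fmul _ _ = fset0) ?cardfs0//.
  by apply/fsetP => h; rewrite inE; apply/fmulP => -[d]; rewrite inE.
rewrite fmul_fsetU1 cardfsU1 dD mulnDl mul1n.
by apply: leq_trans (leq_card_fsetU _ _).1 _; rewrite card_lcos leq_add2l.
Qed.

Lemma fmulA D E F : fmul D (fmul E F) = fmul (fmul D E) F.
Proof.
apply/fsetP => h; apply/fmulP/fmulP.
  move=> [d dD /fmulP[e eE eF]]; exists (d * e)%g; first exact: mem_fmul.
  by rewrite invgM -mulgA.
move=> [x /fmulP[d dD xE] xF]; exists d => //; apply/fmulP; exists (d^-1 * x)%g => //.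
by rewrite invgM invgK -mulgA mulVKg.
Qed.

Lemma fmulSS D D' E E' : D `<=` D' -> E `<=` E' -> fmul D E `<=` fmul D' E'.
Proof.
move=> /fsubsetP DD /fsubsetP EE; apply/fsubsetP => h /fmulP[d /DD dD /EE dE].
by apply/fmulP; exists d.
Qed.

Lemma fsub_fmul1 D E : (1 \in E)%g -> D `<=` fmul D E.
Proof.
by move=> E1; apply/fsubsetP => d dD; rewrite -[d]mulg1; exact: mem_fmul.
Qed.

Lemma fbdP Q T g : reflect ((exists2 q, q \in Q & (g * q)%g \in T) /\
  (exists2 q, q \in Q & (g * q)%g \notin T)) (g \in fbd Q T).
Proof.
rewrite !inE; apply: (iffP andP) => -[].
  move=> /fmulP[t tT]; rewrite in_fsinv invgM invgK => gQ /fsubsetPn[h].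
  rewrite in_lcos => hQ hT; split; last by exists (g^-1 * h)%g; rewrite ?mulVKg.
  by exists (g^-1 * t)%g; rewrite ?mulVKg.
move=> [q qQ gqT] [q' qQ' gqT']; split.
  by apply/fmulP; exists (g * q)%g => //; rewrite in_fsinv invgM invgK mulKg.
by apply/fsubsetPn; exists (g * q')%g => //; rewrite in_lcos mulKg.
Qed.

Lemma fbdS Q Q' T : Q `<=` Q' -> fbd Q T `<=` fbd Q' T.
Proof.
move=> /fsubsetP QQ; apply/fsubsetP => g /fbdP[[q /QQ ? ?] [q' /QQ ? ?]].
by apply/fbdP; split; [exists q|exists q'].
Qed.

Lemma fmul_fbd E Q : fmul E Q `\` E `<=` fbd (1%g |` fsinv Q) E.
Proof.
apply/fsubsetP => h; rewrite inE => /andP[hE /fmulP[e eE eQ]].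
apply/fbdP; split; last by exists 1%g; rewrite ?fset1U1 ?mulg1.
exists (h^-1 * e)%g; last by rewrite mulVKg.
by apply/fset1Ur; rewrite in_fsinv invgM invgK.
Qed.

Lemma card_sub_fset (T : choiceType) (J : {fset T}) (P : pred T) :
  #|[set g : J | P (val g)]%SET| = #|` [fset g in J | P g]|.
Proof.
transitivity #|` [fset val g | g in [set g : J | P (val g)]%SET]|.
  by rewrite card_imfset ?cardE//; exact: val_inj.
congr #|` _|; apply/fsetP => g; apply/imfsetP/idP => /=.
  by move=> [[h hJ]]; rewrite !inE/= => Ph ->; rewrite hJ.
by rewrite !inE/= => /andP[gJ Pg]; exists [` gJ]; rewrite ?inE.
Qed.

(** The relevant [g] are the [t q^-1]. This is the uniform covering that [shearer] needs. *)
Lemma card_lcos_in Q T J : fmul T (fsinv Q) `<=` J ->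
  forall t, t \in T -> #|[set g : J | t \in lcos (val g) Q]%SET| = #|` Q|.
Proof.
move=> /fsubsetP TJ t tT.
rewrite (card_sub_fset _ (fun g => t \in lcos g Q)).
have <- : #|` [fset (t * q^-1)%g | q in Q]| = #|` Q|.
  by apply: card_imfset => x y /mulgI /invg_inj.
congr #|` _|; apply/fsetP => g; apply/idP/imfsetP => /=.
  rewrite !inE/= in_lcos => /andP[gJ tQ]; exists (g^-1 * t)%g => //.
  by rewrite invgM invgK mulVKg.
move=> [q qQ ->]; rewrite !inE/= in_lcos invgM invgK mulgVK qQ andbT.
by apply: TJ; apply: mem_fmul => //; rewrite in_fsinv invgK.
Qed.

(** The non-boundary [g] have [g Q] inside [T], and right multiplication by a fixed point of [Q]
    injects them into [T]. *)
Lemma card_fmul_fsinv Q T : Q != fset0 ->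
  (#|` fmul T (fsinv Q)| <= #|` T| + #|` fbd Q T|)%N.
Proof.
move=> /fset0Pn[q qQ].
set J := fmul _ _.
pose I := [fset g in J | lcos g Q `<=` T].
have JI : J `<=` I `|` fbd Q T.
  by apply/fsubsetP => g gJ; rewrite !inE/= gJ /=; case: (_ `<=` _).
apply: leq_trans (fsubset_leq_card JI) _.
apply: leq_trans (leq_card_fsetU _ _).1 _; rewrite leq_add2r.
have <- : #|` [fset (g * q)%g | g in I]| = #|` I|.
  by apply: card_imfset => x y /mulIg.
apply: fsubset_leq_card; apply/fsubsetP => h /imfsetP[g /=].
rewrite !inE/= => /andP[_ /fsubsetP gT] ->; apply: gT.
by rewrite in_lcos mulKg.
Qed.

End fset_products.

(** * Comparison of pattern counts *)

Section pattern_counts.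
Variables (G : groupType).

(** Choosing for each pattern of [Y] that of a related point of [X] is injective. A relation is used
    because the correspondence may be multivalued and only partly defined on [X]. *)
Lemma npat_le (A B : finType) (X : set (config G A)) (Y : set (config G B))
    (K L : {fset G}) (r : config G A -> config G B -> Prop) :
  (forall y, Y y -> exists2 x, X x & r x y) ->
  (forall x x' y y', X x -> X x' -> Y y -> Y y' -> r x y -> r x' y' ->
     restr K x = restr K x' -> restr L y = restr L y') ->
  (npat Y L <= npat X K)%N.
Proof.
move=> Yr rd; have [->|/set0P[y0 /Yr[x0 _ _]]] := eqVneq Y set0; first by rewrite npat_set0.
have /choice[w wP] : forall q, exists p : {ffun K -> A}, patterns Y L q ->
    exists x y, [/\ X x, Y y & r x y] /\ restr L y = q /\ restr K x = p.
  move=> q; have [[y Yy yq]|Nq] := pselect (patterns Y L q); last by exists (restr K x0).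
  by have [x Xx rxy] := Yr y Yy; exists (restr K x) => _; exists x, y.
have winj : {in [set p | `[< patterns Y L p >]]%SET &, injective w}.
  move=> q q'; rewrite !inE => /wP[x [y [[Xx Yy rxy] [<- <-]]]].
  by move=> /wP[x' [y' [[Xx' Yy' rxy'] [<- <-]]]]; exact: rd.
rewrite !npatE -(card_in_imset winj); apply: subset_leq_card.
apply/fintype.subsetP => p /imsetP[q]; rewrite !inE => /wP[x [y [[Xx _ _] [_ xw]]]] ->.
by exists x.
Qed.

Lemma npat_bigcup (A : finType) (I : finType) (X : set (config G A))
    (Z : I -> set (config G A)) (L : {fset G}) :
  (forall x, X x -> exists i, Z i x) ->
  (npat X L <= \sum_i npat (Z i) L)%N.
Proof.
move=> XZ; under eq_bigr do rewrite npatE; rewrite npatE.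
apply: (@leq_trans #|(\bigcup_i [set p | `[< patterns (Z i) L p >]])%SET|).
  apply: subset_leq_card; apply/fintype.subsetP => p; rewrite inE => /asboolP[x Xx xp].
  have [i Zx] := XZ x Xx; apply/finset.bigcupP; exists i => //.
  by rewrite !inE; exists x.
by apply: (big_ind2 (fun (x : {set _}) n => #|x| <= n)%N); rewrite ?cards0// => x m y n xm yn;
  apply: leq_trans (leq_card_setU _ _).1 (leq_add xm yn).
Qed.

Lemma npat_translate (A : finType) (X : subshift G A) g (K : {fset G}) :
  npat X (lcos g K) = npat X K.
Proof.
have le h L : (npat X (lcos h L) <= npat X L)%N.
  apply: (npat_le (r := fun x y => y = gact h x)).
    move=> y Xy; exists (gact h^-1 y); first exact: shift_invariant.
    by apply/funext => k; rewrite /gact invgK mulVKg.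
  move=> x x' _ _ _ _ _ _ -> -> /restrP xx; apply/restrP => k.
  by rewrite in_lcos /gact => /xx.
apply/eqP; rewrite eqn_leq le/=.
rewrite [leqLHS](_ : _ = npat X (lcos g^-1 (lcos g K))) ?le//; congr npat.
by apply/fsetP => k; rewrite !in_lcos invgK mulKg.
Qed.

(** Apply [shearer] to the translates of [L] meeting [T]: by invariance they share one pattern
    count, and [card_fmul_fsinv] bounds their number. *)
Lemma ln_npat_le (R : realType) (A : finType) (X : subshift G A) (L T : {fset G}) :
  (X : set (config G A)) !=set0 -> L != fset0 ->
  #|` L|%:R * ln (npat X T)%:R <=
    (#|` T| + #|` fbd L T|)%:R * ln (npat X L)%:R :> R.
Proof.
move=> X0 L0; have L1 : (0 < #|` L|)%N by rewrite cardfs_gt0.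
pose J := fmul T (fsinv L).
have := @shearer _ _ R J (fun g => lcos (val g) L) _ X T L1
  (card_lcos_in (fsubset_refl _)).
under eq_bigr do rewrite npat_translate.
rewrite prodr_const => le.
have pos K : 0 < (npat X K)%:R :> R by rewrite ltr0n npat_gt0.
rewrite !mulr_natl -!lnXn//.
apply: (@le_trans _ _ (ln ((npat X L)%:R ^+ #|{: J}|))).
  by rewrite ler_ln ?posrE ?exprn_gt0.
rewrite !lnXn// ler_wpMn2l//; first by rewrite ln_ge0// ler1n npat_gt0.
by rewrite -cardfE; exact: card_fmul_fsinv.
Qed.

End pattern_counts.

(** * Entropy as an infimum *)

Section folner_sets.
Variables (R : realType) (G : groupType) (S : {fset G}).
Hypothesis gen : generating S.

Lemma card_fbd_boundary (Q : {fset G}) : exists r, forall T : {fset G},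
  (#|` fbd Q T| <= #|` fset_set (boundary S r T)|)%N.
Proof.
exists (\max_(q <- Q) word_dist S 1%g q)%N => T; apply: fsubset_leq_card.
apply/fsubsetP => g /fbdP[[q qQ gqT] [q' qQ' gqT']].
rewrite in_fset_set; last exact: finite_boundary.
have ball x : x \in Q -> word_ball S (\max_(q <- Q) word_dist S 1%g q)%N x.
  by move=> xQ; exact: (@leq_bigmax_seq _ _ xpredT (word_dist S 1%g) x).
apply/mem_set; split.
  by exists (g * q)%g; split => //; exists q => //; exact: ball.
exists (g * q')%g; split; first by exists q' => //; exact: ball.
by move=> /=; apply/negP.
Qed.

Lemma folner_fbd (F : nat -> {fset G}) (Q : {fset G}) : folner R S F ->
  #|` fbd Q (F n)|%:R / #|` F n|%:R @[n --> \oo] --> (0 : R).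
Proof.
move=> [_ Fr]; have [r rQ] := card_fbd_boundary Q.
apply: (squeeze_cvgr _ (cvg_cst 0) (Fr r)).
apply: nearW => n; rewrite divr_ge0//= ler_wpM2r ?invr_ge0//.
by rewrite ler_nat rQ.
Qed.

Lemma invariant_fset (Q : {fset G}) (e : R) : amenable R S -> 0 < e ->
  exists2 E : {fset G}, E != fset0 & #|` fbd Q E|%:R <= e * #|` E|%:R.
Proof.
move=> [F FS] e0; have /cvgr0Pnorm_le /(_ _ e0)[N _ /(_ N (leqnn _))] := folner_fbd Q FS.
have F0 : 0 < #|` F N|%:R :> R by rewrite ltr0n cardfs_gt0; case: FS.
rewrite ger0_norm ?divr_ge0// ler_pdivrMr// => le.
by exists (F N) => //; case: FS.
Qed.

Lemma folner_fmul (F : nat -> {fset G}) (Q : {fset G}) (e : R) :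
  folner R S F -> 0 < e ->
  \forall n \near \oo, #|` fmul (F n) Q|%:R <= (1 + e) * #|` F n|%:R.
Proof.
move=> FS e0.
have /cvgr0Pnorm_le /(_ _ e0) := folner_fbd (1%g |` fsinv Q)%fset FS.
apply: filterS => n; set E := F n.
have E0 : 0 < #|` E|%:R :> R by rewrite ltr0n cardfs_gt0; exact: FS.1.
rewrite ger0_norm ?divr_ge0// ler_pdivrMr// => le.
rewrite mulrDl mul1r; apply: le_trans (lerD (lexx _) le).
rewrite -natrD ler_nat -leq_subLR.
apply: leq_trans (fsubset_leq_card (fmul_fbd E Q)).
by rewrite cardfsD leq_sub2l// fsubset_leq_card// fsubsetIr.
Qed.

Lemma invariant_fset_fmul (Q : {fset G}) (e : R) : amenable R S -> 0 < e ->
  exists2 E : {fset G}, E != fset0 & #|` fmul E Q|%:R <= (1 + e) * #|` E|%:R.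
Proof.
move=> [F FS] e0; have /filter_ex[N le] := folner_fmul Q FS e0.
by exists (F N) => //; case: FS.
Qed.

(* A set smaller than some [Q] is contained in its own [Q]-boundary. *)
Lemma invariant_fset_large (Q : {fset G}) (e : R) (m : nat) :
  infinite_set [set: G] -> amenable R S -> 0 < e < 1 ->
  exists2 E : {fset G}, (m <= #|` E|)%N & #|` fbd Q E|%:R <= e * #|` E|%:R.
Proof.
move=> /(infinite_set_fset m)[B _ mB] am /andP[e0 e1].
pose Q' := (1%g |` (B `|` Q))%fset.
have BQ : (B `<=` Q')%fset by apply/fsubsetP => x xB; rewrite !inE xB orbT.
have QQ : (Q `<=` Q')%fset by apply/fsubsetP => x xQ; rewrite !inE xQ !orbT.
have [E E0 le] := invariant_fset Q' am e0.
have E1 : 0 < #|` E|%:R :> R by rewrite ltr0n cardfs_gt0.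
exists E; last by apply: le_trans le; rewrite ler_nat fsubset_leq_card// fbdS.
rewrite leqNgt; apply/negP => Em.
suff : (E `<=` fbd Q' E)%fset.
  by move=> /fsubset_leq_card; rewrite -(ler_nat R) leNgt (le_lt_trans le)// gtr_pMl.
apply/fsubsetP => g gE; apply/fbdP; split.
  by exists 1%g; rewrite ?fset1U1 ?mulg1.
have /fsubsetPn[h] : ~~ (lcos g Q' `<=` E)%fset.
  apply/negP => /fsubset_leq_card; rewrite card_lcos leqNgt => /negP; apply.
  exact: leq_trans Em (leq_trans mB (fsubset_leq_card BQ)).
by rewrite in_lcos => hQ hE; exists (g^-1 * h)%g; rewrite ?mulVKg.
Qed.

Section entropy.
Variables (A : finType) (X : subshift G A).
Hypothesis X0 : (X : set (config G A)) !=set0.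

Let rate (K : {fset G}) : R := ln (npat X K)%:R / #|` K|%:R.
Definition entropy_inf : R := inf [set rate K | K in [set K | K != fset0]].

Lemma entropy_inf_le K : K != fset0 -> entropy_inf <= rate K.
Proof.
move=> K0; apply: inf_lbound; last by exists K.
by exists 0 => _ [L _ <-]; rewrite divr_ge0// ln_ge0// ler1n npat_gt0.
Qed.

Lemma entropy_inf_lt e : 0 < e -> exists2 K, K != fset0 & rate K < entropy_inf + e.
Proof.
move=> e0; have [|_ [K K0 <-] lt] := @inf_adherent _ [set rate K | K in [set K | K != fset0]] _ e0.
  split.
    by exists (rate [fset 1%g]%fset), [fset 1%g]%fset => //; apply/fset0Pn; exists 1%g; rewrite inE.
  by exists 0 => _ [L _ <-]; rewrite divr_ge0// ln_ge0// ler1n npat_gt0.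
by exists K.
Qed.

(** The infimum bounds every rate from below. A nearly optimal window [K] gives the upper bound
    through [ln_npat_le], whose boundary term vanishes along [F]. *)
Lemma rate_cvg (F : nat -> {fset G}) : folner R S F ->
  rate (F n) @[n --> \oo] --> entropy_inf.
Proof.
move=> FS; have F0 n : F n != fset0 by case: FS.
have Fp n : 0 < #|` F n|%:R :> R by rewrite ltr0n cardfs_gt0.
apply/cvgrPdist_le => e e0.
have e20 : 0 < e / 2 by rewrite divr_gt0.
have [K K0 Kh] := entropy_inf_lt e20.
have Kp : 0 < #|` K|%:R :> R by rewrite ltr0n cardfs_gt0.
have r0 : 0 <= rate K by rewrite divr_ge0// ln_ge0// ler1n npat_gt0.
(* Adding 1 keeps the denominator positive when [rate K] is 0. *)
have d0 : 0 < (e / 2) / (rate K + 1) by rewrite divr_gt0// ltr_wpDl.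
have /cvgr0Pnorm_le /(_ _ d0) := folner_fbd K FS; apply: filterS => n.
rewrite ger0_norm ?divr_ge0// => fb.
rewrite distrC ger0_norm ?subr_ge0 ?entropy_inf_le//.
have := ln_npat_le R (F n) X0 K0.
rewrite -ler_pdivlMl// mulrCA mulrC natrD => le.
have {le} : rate (F n) <= rate K * (1 + #|` fbd K (F n)|%:R / #|` F n|%:R).
  rewrite /rate ler_pdivrMr//; apply: le_trans le _.
  by rewrite -/(rate K) le_eqVlt; apply/orP; left; apply/eqP; rewrite /rate; field; rewrite !gt_eqF.
move=> le; rewrite lerBlDr; apply: le_trans le _.
rewrite mulrDr mulr1.
have : rate K * (#|` fbd K (F n)|%:R / #|` F n|%:R) <= e / 2.
  apply: le_trans (ler_wpM2l r0 fb) _.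
  rewrite mulrCA; apply: ler_piMr; first exact: ltW.
  rewrite ler_pdivrMr ?mul1r ?lerDl//.
  by rewrite ltr_wpDl.
lra.
Qed.

Lemma pattern_entropyE K :
  pattern_entropy R X K = (rate K)%:E.
Proof.
rewrite /pattern_entropy lne_EFin; last by rewrite ltr0n npat_gt0.
by rewrite -EFinM mulrC.
Qed.

(** [entropy] is chosen by [get]: [rate_cvg] shows that a common limit exists, and the Følner
    sequence given by amenability makes it unique. *)
Lemma entropyE : amenable R S -> entropy R S X = entropy_inf%:E.
Proof.
move=> [F FS]; rewrite /entropy.
have : [set l | forall F, folner R S F ->
    pattern_entropy R X (F n) @[n --> \oo] --> l] entropy_inf%:E.
  move=> E ES /=; under eq_fun do rewrite pattern_entropyE.
  by apply: cvg_EFin; [exact: nearW|exact: rate_cvg].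
move=> /getI /= /(_ F FS); set l := get _.
under eq_fun do rewrite pattern_entropyE.
move=> Fl; apply: (cvg_unique _ Fl) => //.
by apply: cvg_EFin; [exact: nearW|exact: rate_cvg].
Qed.

End entropy.

Lemma entropy_set0 (A : finType) (X : subshift G A) : amenable R S ->
  (X : set (config G A)) = set0 -> entropy R S X = -oo%E.
Proof.
move=> [F FS] X0; rewrite /entropy.
have pe K : K != fset0 -> pattern_entropy R X K = -oo%E.
  move=> K0; rewrite /pattern_entropy X0 -/(npat set0 K) npat_set0.
  by rewrite /lne lexx gt0_muleNy// lte_fin invr_gt0 ltr0n cardfs_gt0.
have : [set l | forall F, folner R S F ->
    pattern_entropy R X (F n) @[n --> \oo] --> l] -oo%E.
  move=> E [E0 _] /=; under eq_fun do rewrite pe//.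
  exact: cvg_cst.
move=> /getI /= /(_ F FS); set l := get _.
have F0 n : F n != fset0 by case: FS.
under eq_fun do rewrite pe//.
by move=> Fl; apply: (cvg_unique _ Fl) => //; exact: cvg_cst.
Qed.

End folner_sets.

(** * The marker shift *)

Lemma closed_configP (G : groupType) (A : finType) (X : set (config G A)) :
  (forall x, (forall K : {fset G}, exists2 y, X y & restr K x = restr K y) -> X x) ->
  closed X.
Proof.
move=> Xx x clx; apply: Xx => K.
have : nbhs x [set y | restr K x = restr K y] by apply/config_nbhsP; exists K.
by move=> /clx[y [Xy xy]]; exists y.
Qed.

Section markers.
Variables (G : groupType) (V : {fset G}).
Implicit Types (C W Z : set G) (D E : {fset G}) (g h : G).
Hypothesis V0 : V != fset0.
Local Open Scope nat_scope.

Definition covered C h := exists2 v, v \in V & C (h * v^-1)%g.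

(* Hereditary almost-disjointness of the tiles [c V]; it is preserved when a [g]
   at which [dense_at] fails is added to [C], since [g V] then has more than
   3/4 of its points outside the other tiles. *)
Definition sparse C := forall D, [set` D] `<=` C -> 3 * (#|` D| * #|` V|) <= 4 * #|` fmul D V|.

Definition dense_at C g := #|` V| <= 4 * #|` [fset h in lcos g V | `[< covered C h >]]%fset|.

Let V1 : 0 < #|` V|. Proof. by rewrite cardfs_gt0. Qed.

Lemma sparse_set0 : sparse set0.
Proof.
move=> D D0; rewrite (_ : D = fset0) ?cardfs0//.
by apply/fsetP => d; rewrite inE; apply/negP => /D0.
Qed.

Lemma dense_atS C C' g :
  (forall h, h \in lcos g V -> covered C h -> covered C' h) ->
  dense_at C g -> dense_at C' g.
Proof.
move=> CC; rewrite /dense_at => /leq_trans; apply; rewrite leq_mul2l/=.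
apply: fsubset_leq_card; apply/fsubsetP => h; rewrite !inE/= => /andP[hV /asboolP Ch].
by rewrite hV; apply/asboolP; exact: CC.
Qed.

Lemma covered_fmul C D h : (forall d, d \in D -> C d) -> h \in fmul D V -> covered C h.
Proof.
move=> DC /fmulP[d /DC Cd dh]; exists (d^-1 * h)%g => //.
by rewrite invgM invgK mulVKg.
Qed.

(** Zorn's lemma on the sets of markers that may be added outside [W]. Where density failed outside
    [W], one more marker could be added to a maximal set. *)
Lemma sparse_extend C0 W : sparse C0 -> exists C,
  [/\ C0 `<=` C, sparse C, (forall g, C g -> W g -> C0 g) &
      forall g, ~ W g -> dense_at C g].
Proof.
move=> spC0.
pose P : set (set G) := [set Z | (forall z, Z z -> ~ W z) /\ sparse (C0 `|` Z)].
have [|Z [[ZW spZ] Zmax]] := @Zorn_bigcup _ P.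
  move=> F FP Ftot; split; first by move=> z [Z /FP[ZW _] Zz]; exact: ZW.
  move=> D DU.
  (* Sparseness has finite character: a finite [D] needs a single member of the chain, or none. *)
  have [Z [ZF DZ]] : exists Z, (Z = set0 \/ F Z) /\ [set` D] `<=` C0 `|` Z.
    elim/fset1U_rect: D DU => [|d D dD IH] DU.
      by exists set0; split; [left|].
    have [|Z [ZF DZ]] := IH; first by move=> x xD; apply: DU; rewrite /= inE xD orbT.
    have [dC0|[Z' FZ' Z'd]] := DU d (fset1U1 _ _).
      exists Z; split => // x /=; rewrite !inE => /predU1P[->|xD]; first by left.
      exact: DZ.
    case: ZF => [Z0|FZ].
      exists Z'; split; first by right.
      move=> x /=; rewrite !inE => /predU1P[->|xD]; first by right.
      by have [|] := DZ x xD; [left|rewrite Z0].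
    have [ZZ|ZZ] := Ftot _ _ FZ FZ'.
      exists Z'; split; first by right.
      move=> x /=; rewrite !inE => /predU1P[->|xD]; first by right.
      by have [|/ZZ] := DZ x xD; [left|right].
    exists Z; split; first by right.
    move=> x /=; rewrite !inE => /predU1P[->|xD]; last exact: DZ.
    by right; exact: ZZ.
  case: ZF => [Z0|/FP[_ spZ]]; last exact: spZ.
  by apply: spC0 => x /DZ; rewrite Z0 setU0.
exists (C0 `|` Z); split => //; first by move=> g [//|/ZW].
move=> g Wg; apply: contrapT => ndense.
(* A marker already present covers its whole tile, so density cannot fail there. *)
have Zg : ~ (C0 `|` Z) g.
  move=> Cg; apply: ndense; rewrite /dense_at.
  have -> : [fset h in lcos g V | `[< covered (C0 `|` Z) h >]]%fset = lcos g V.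
    apply/fsetP => h; rewrite !inE/=; case: (boolP (h \in lcos g V)) => //= hV.
    apply/asboolP; exists (g^-1 * h)%g; first by rewrite -in_lcos.
    by rewrite invgM invgK mulVKg.
  by rewrite card_lcos leq_pmull.
apply: (Zmax (Z `|` [set g])).
  split; first by move=> z; left.
  by move=> /(_ g (or_intror erefl)) gZ; apply: Zg; right.
split; first by move=> z [/ZW//|->].
move=> D DC; have [gD|gD] := boolP (g \in D); last first.
  apply: spZ => x xD; have [|[|xg]] := DC x xD; [by left|by right|].
  by move: gD; rewrite -xg xD.
pose D' := (D `\ g)%fset.
have D'C x : x \in D' -> (C0 `|` Z) x.
  rewrite !inE => /andP[/eqP xg xD]; have [|[|//]] := DC x xD; first by left.
  by right.
have := spZ D' D'C.
rewrite -(fsetD1K gD) fmul_fsetU1 -/D' cardfsU1 !inE eqxx/= add1n.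
rewrite cardfsU card_lcos.
(* The overlap with the old tiles is covered, hence less than a quarter of the new tile; the other
   three quarters pay for the new marker. *)
have : (lcos g V `&` fmul D' V `<=` [fset h in lcos g V | `[< covered (C0 `|` Z) h >]])%fset.
  apply/fsubsetP => h; rewrite !inE/= => /andP[-> hD]; apply/asboolP.
  exact: covered_fmul hD.
move=> /fsubset_leq_card; move: ndense; rewrite /dense_at => /negP.
rewrite -ltnNge; move: #|` _| #|` fmul _ _| #|` D'| #|` (_ `&` _)%fset| => a b c d.
by rewrite (mulSn c); move: (c * _) => e; move: #|` V| => v; lia.
Qed.

End markers.

Section marker_shift.
Variables (G : groupType) (V : {fset G}).
Implicit Types (C W Z : set G) (D E : {fset G}) (g h : G).
Hypothesis V0 : V != fset0.

Definition marks (y : config G bool) : set G := [set g | y g = true].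

Definition marker_set : set (config G bool) :=
  [set y | sparse V (marks y) /\ forall g, dense_at V (marks y) g].

(** Both conditions are tested on finite windows: density at [g] involves only markers in
    [g V V^-1]. *)
Lemma marker_closed : closed marker_set.
Proof.
apply: closed_configP => y Hy; split=> [D Dy|g].
  have [z [zs _] /restrP yz] := Hy D.
  by apply: zs => d dD; rewrite /marks /= -yz//; exact: Dy.
have [z [_ zd] /restrP yz] := Hy (fmul (lcos g V) (fsinv V)).
apply: dense_atS (zd g) => h hV [v vV zv]; exists v => //.
by rewrite /marks /= yz//; apply: mem_fmul => //; rewrite in_fsinv invgK.
Qed.

Lemma fmul_lcos g D E : fmul (lcos g D) E = lcos g (fmul D E).
Proof.
apply/fsetP => h; rewrite in_lcos; apply/fmulP/fmulP => -[d].
  rewrite in_lcos => dD dE; exists (g^-1 * d)%g => //.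
  by rewrite invgM invgK mulgA mulgK.
move=> dD dE; exists (g * d)%g; first by rewrite in_lcos mulKg.
by rewrite invgM -mulgA.
Qed.

Lemma marker_invariant k y : marker_set y -> marker_set (gact k y).
Proof.
move=> [ys yd]; split=> [D Dy|g].
  rewrite -(card_lcos k^-1%g D) -(card_lcos k^-1%g (fmul D V)) -fmul_lcos.
  by apply: ys => d; rewrite /= in_lcos invgK => /Dy; rewrite /marks /gact /= mulKg.
have := yd (k^-1 * g)%g; rewrite /dense_at => /leq_trans; apply.
rewrite leq_mul2l/= -(card_lcos k).
apply: fsubset_leq_card; apply/fsubsetP => h; rewrite in_lcos !inE/= !in_lcos.
rewrite invgM invgK -mulgA mulVKg => /andP[-> /asboolP[v vV yv]].
by apply/asboolP; exists v => //; move: yv; rewrite /marks /gact /= mulgA.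
Qed.

Definition marker_shift : subshift G bool := Shift marker_closed marker_invariant.

Let indic C : config G bool := fun g => `[< C g >].

Let marks_indic C : marks (indic C) = C.
Proof. by apply/seteqP; split => g /asboolP. Qed.

Lemma marker_shift_neq0 : exists y, shift_set marker_shift y.
Proof.
have [C [_ Cs _ Cd]] := sparse_extend V0 set0 (sparse_set0 V).
by exists (indic C); split; rewrite marks_indic// => g; exact: Cd.
Qed.

Local Open Scope nat_scope.

Lemma sparseU C1 C2 : sparse V C1 -> sparse V C2 ->
  (forall c1 c2, C1 c1 -> C2 c2 -> [disjoint lcos c1 V & lcos c2 V]%fset) ->
  sparse V (C1 `|` C2).
Proof.
move=> s1 s2 dis D DC.
pose D1 := [fset d in D | `[< C1 d >]]%fset; pose D2 := (D `\` D1)%fset.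
have D1C d : d \in D1 -> C1 d by rewrite !inE/= => /andP[_ /asboolP].
have D2C d : d \in D2 -> C2 d.
  rewrite !inE/= => /andP[/negP nd dD]; have [Cd|//] := DC d dD.
  by case: nd; rewrite dD; apply/asboolP.
have := s1 D1 D1C; have := s2 D2 D2C.
have -> : #|` D| = #|` D1| + #|` D2|.
  rewrite -(cardfsID D1 D) (fsetIidPr _)//.
  by apply/fsubsetP => d; rewrite !inE => /andP[].
suff : #|` fmul D1 V| + #|` fmul D2 V| <= #|` fmul D V|.
  rewrite mulnDl; move: (#|` D1| * #|` V|) (#|` D2| * #|` V|) => a b.
  by move: #|` fmul D1 V| #|` fmul D2 V| #|` fmul D V| => u v w; lia.
rewrite -cardfsUI (_ : _ `&` _ = fset0)%fset; last first.
  apply/eqP; rewrite -fsubset0; apply/fsubsetP => h.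
  rewrite inE => /andP[/fmulP[c1 /D1C c1C c1h] /fmulP[c2 /D2C c2C c2h]].
  have /fdisjointP/(_ h) := dis _ _ c1C c2C.
  by rewrite !in_lcos c1h => /(_ isT); rewrite c2h.
rewrite cardfs0 addn0; apply: fsubset_leq_card; rewrite fsubUset !fmulSS//.
  exact: fsubsetDl.
by apply/fsubsetP => d; rewrite !inE => /andP[].
Qed.

Lemma sparseS C C' : C `<=` C' -> sparse V C' -> sparse V C.
Proof. by move=> CC s D DC; apply: s => d /DC /CC. Qed.

(** Keep the markers of [y1] near [K] and those of [y2] near [H], then complete by [sparse_extend]
    without new markers in [K] or [H]. *)
Lemma marker_strongly_irreducible (S : {fset G}) :
  strongly_irreducible S marker_shift.
Proof.
(* Markers whose tiles meet [g V] lie in [g N], and their tiles in [g NV]. A common point of [K NV]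
   and [H NV] would put some [k^-1 l] in [Q], against the gap. *)
pose N := fmul V (fsinv V); pose NV := fmul N V.
pose Q := fmul NV (fsinv NV).
exists (\max_(q <- Q) word_dist S 1%g q) => K H far y1 y2 [s1 d1] [s2 d2].
have [v0 v0V] := fset0Pn _ V0.
have N1 : 1%g \in N by apply/fmulP; exists v0; rewrite // in_fsinv mulg1 invgK.
have dis h : h \in fmul K NV -> h \in fmul H NV -> False.
  move=> /fmulP[k kK kh] /fmulP[l lH lh].
  have := far k l kK lH; rewrite ltnNge => /negP; apply.
  have -> : word_dist S k l = word_dist S 1%g (k^-1 * l)%g.
    by rewrite -(word_dist_left S k^-1%g) mulVg.
  apply: (@leq_bigmax_seq _ _ xpredT (word_dist S 1%g)) => //.
  apply/fmulP; exists (k^-1 * h)%g => //.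
  by rewrite in_fsinv !invgM !invgK -mulgA mulVKg.
pose C0 := (marks y1 `&` [set` fmul K N]) `|` (marks y2 `&` [set` fmul H N]).
have C0s : sparse V C0.
  apply: sparseU; [by apply: sparseS s1|by apply: sparseS s2|].
  move=> c1 c2 [_ c1K] [_ c2H]; apply/fdisjointP => h; rewrite !in_lcos => c1h.
  apply/negP => c2h; apply: (dis h); rewrite fmulA.
    by apply/fmulP; exists c1.
  by apply/fmulP; exists c2.
have [C [C0C Cs CW Cd]] := sparse_extend V0 ([set` K] `|` [set` H]) C0s.
have KN k : k \in K -> k \in fmul K N by apply/fsubsetP/fsub_fmul1.
have HN k : k \in H -> k \in fmul H N by apply/fsubsetP/fsub_fmul1.
have disN h : h \in fmul K N -> h \in fmul H N -> False.
  move=> hK hH; apply: (dis (h * v0)%g); rewrite fmulA; exact: mem_fmul.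
have Eb (b1 b2 : bool) : (b1 = true <-> b2 = true) -> b1 = b2.
  by case: b1 b2 => [] [] [] // a b; [have := a erefl|have := b erefl].
have near g h v : h \in lcos g V -> v \in V -> (g^-1 * (h * v^-1))%g \in N.
  rewrite in_lcos => hV vV; apply/fmulP; exists (g^-1 * h)%g => //.
  by rewrite in_fsinv (mulgA g^-1%g) mulKg invgK.
exists (indic C); split.
- split; rewrite marks_indic// => g.
  have [gK|gK] := boolP (g \in K).
    apply: dense_atS (d1 g) => h hV [v vV yv]; exists v => //; apply: C0C; left.
    by split => //=; apply/fmulP; exists g => //; exact: near.
  have [gH|gH] := boolP (g \in H).
    apply: dense_atS (d2 g) => h hV [v vV yv]; exists v => //; apply: C0C; right.
    by split => //=; apply/fmulP; exists g => //; exact: near.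
  by apply: Cd => -[]; exact/negP.
- apply/restrP => k kK; apply: Eb; split => [/asboolP Ck|y1k].
    have [[y1k _]|[_ kH]] := CW k Ck (or_introl kK); first exact: y1k.
    by case: (disN k (KN _ kK) kH).
  by apply/asboolP/C0C; left; split => //; exact: KN.
- apply/restrP => k kH; apply: Eb; split => [/asboolP Ck|y2k].
    have [[_ kK]|[y2k _]] := CW k Ck (or_intror kH); last exact: y2k.
    by case: (disN k kK (HN _ kH)).
  by apply/asboolP/C0C; right; split => //; exact: HN.
Qed.

Lemma sparse_card C D E : sparse V C -> [set` D] `<=` C -> (D `<=` E)%fset ->
  3 * (#|` D| * #|` V|) <= 4 * #|` fmul E V|.
Proof.
move=> /(_ D) s /s /leq_trans le DE; apply: le.
by rewrite leq_mul2l/= fsubset_leq_card// fmulSS.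
Qed.

(** Count the pairs [(g, v)] with [g v] covered: density bounds them below, and for fixed [v] the
    map [g] to [g v] injects into the tiles of the markers counted. *)
Lemma dense_card C E : (forall g, dense_at V C g) ->
  #|` E| <= 4 * (#|` [fset h in fmul E (fmul V (fsinv V)) | `[< C h >]]%fset| * #|` V|).
Proof.
move=> Cd; set D := [fset h in _ | _]%fset.
have V1 : 0 < #|` V| by rewrite cardfs_gt0.
rewrite -(leq_pmul2r V1).
apply: (@leq_trans (\sum_(g <- E) 4 * \sum_(v <- V) `[< covered V C (g * v)%g >])).
  rewrite card_fset_sum1 big_distrl/=; apply: leq_sum => g _; rewrite mul1n.
  apply: leq_trans (Cd g) _; rewrite leq_mul2l/=.
  rewrite [X in #|` X|](_ : _ = lcos g [fset v in V | `[< covered V C (g * v)%g >]]%fset).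
    by rewrite card_lcos card_fset_sum1 -big_fset_condE big_mkcond.
  by apply/fsetP => h; rewrite in_lcos !inE/= in_lcos mulVKg.
rewrite -big_distrr/= exchange_big/= -mulnA leq_mul2l/=.
apply: (@leq_trans (\sum_(v <- V) #|` fmul D V|)); last first.
  rewrite big_const_seq count_predT iter_addn_0 leq_mul2r.
  by apply/orP; right; exact: card_fmul.
rewrite big_seq [leqRHS]big_seq; apply: leq_sum => v vV.
rewrite -big_mkcond/= big_fset_condE -card_fset_sum1.
set Ev := [fset g in E | _]%fset.
have <- : #|` [fset (g * v)%g | g in Ev]%fset| = #|` Ev|.
  by apply: card_imfset => x y /mulIg.
apply: fsubset_leq_card; apply/fsubsetP => h /imfsetP[g /=].
rewrite !inE/= => /andP[gE /asboolP[u uV Cu]] ->.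
apply/fmulP; exists (g * v * u^-1)%g; last by rewrite invgM invgK mulgVK.
rewrite !inE/=; apply/andP; split; last exact/asboolP.
by rewrite -mulgA mem_fmul// mem_fmul// in_fsinv invgK.
Qed.

End marker_shift.

(** * Erasing tiles *)

(** [V] is a union of [M] disjoint translates [F t]; as the group is infinite, some [t] lies outside
    [F^-1 V]. Since [D (F t) = (D F) t], sparseness will pass from [V] to [F]. *)
Lemma spread_tile (G : groupType) (F : {fset G}) (M : nat) : infinite_set [set: G] ->
  exists V : {fset G}, #|` V| = (M * #|` F|)%N /\
    forall D, (#|` fmul D V| <= M * #|` fmul D F|)%N.
Proof.
move=> inf; elim: M => [|M [V [cV DV]]].
  exists fset0; split=> [|D]; first by rewrite cardfs0.
  by apply: leq_trans (card_fmul _ _) _; rewrite cardfs0 muln0.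
have [t tF] : exists t, t \notin fmul (fsinv F) V.
  apply: contrapT => /forallNP nt; apply: inf.
  apply: sub_finite_set (finite_fset (fmul (fsinv F) V)) => t _ /=.
  by apply/negPn/negP/nt.
pose Ft := [fset (f * t)%g | f in F]%fset.
exists (V `|` Ft)%fset; split.
  rewrite cardfsU (_ : _ `&` _ = fset0)%fset ?cardfs0 ?subn0.
    rewrite cV mulSn addnC; congr (_ + _)%N.
    by apply: card_imfset => x y /mulIg.
  apply/fsetP => h; rewrite !inE; apply/negP => /andP[hV /imfsetP[f /= fF hf]].
  move: tF => /negP; apply; apply/fmulP; exists f^-1%g; first by rewrite in_fsinv invgK.
  by rewrite invgK -hf.
move=> D; rewrite mulSn addnC.
have sub : (fmul D (V `|` Ft) `<=` fmul D V `|` [fset (h * t)%g | h in fmul D F])%fset.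
  apply/fsubsetP => h /fmulP[d dD]; rewrite !inE => /orP[dV|/imfsetP[f /= fF df]].
    by apply/orP; left; apply/fmulP; exists d.
  apply/orP; right; apply/imfsetP; exists (d * f)%g => /=; first exact: mem_fmul.
  by rewrite -mulgA -df mulVKg.
apply: leq_trans (fsubset_leq_card sub) _; apply: leq_trans (leq_card_fsetU _ _).1 _.
rewrite leq_add ?DV// [leqLHS](_ : _ = #|` fmul D F|)//.
by apply: card_imfset => x y /mulIg.
Qed.

Section erase.
Variables (G : groupType) (A : finType) (X : set (config G A)) (F B : {fset G}).
Variable x0 : config G A.
Hypothesis B1 : 1%g \in B.
Implicit Types (C : set G) (x : config G A) (c g h : G).

(* The points of the tile [c F] at [B]-distance from its complement and from the
   other tiles; distinct cores are therefore disjoint even if the tiles overlap. *)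
Definition core C c : set G := [set h | forall b, b \in B ->
  (c^-1 * (h * b))%g \in F /\
  forall c', C c' -> c' <> c -> (c'^-1 * (h * b))%g \notin F].

Definition shape C c : set G := [set f | core C c (c * f)%g].

(* The value depends on [x] only through its restriction to [F] minus [W]
   (lemma [eq_canon]), which is why erasing loses entropy. *)
Definition canon (W : set G) x : config G A :=
  xget x0 [set v | X v /\ forall f, f \in F -> ~ W f -> v f = x f].

Definition erase C x : config G A := fun h =>
  let c := xget 1%g [set c | C c /\ core C c h] in
  if `[< C c /\ core C c h >] then canon (shape C c) (gact c^-1 x) (c^-1 * h)%g
  else x h.

Lemma canonP W x : X x ->
  X (canon W x) /\ forall f, f \in F -> ~ W f -> canon W x f = x f.
Proof.
by move=> Xx; apply: (@xgetPex _ x0 [set v | X v /\ forall f, f \in F -> ~ W f -> v f = x f]); exists x.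
Qed.

Lemma eq_canon W x x' : (forall f, f \in F -> ~ W f -> x f = x' f) ->
  canon W x = canon W x'.
Proof.
move=> xx; congr (xget x0 _); apply/seteqP; split => v [Xv vx]; split => // f fF Wf.
  by rewrite vx// xx.
by rewrite vx// xx.
Qed.

Lemma core_tile C c h : core C c h -> (c^-1 * h)%g \in F.
Proof. by move=> /(_ _ B1)[]; rewrite mulg1. Qed.

Lemma core_uniq C c c' h : core C c h -> C c' -> (c'^-1 * h)%g \in F -> c' = c.
Proof.
move=> /(_ _ B1)[_ H] Cc'; rewrite mulg1 in H => cF; apply: contrapT => cc.
by move: (H _ Cc' cc); rewrite cF.
Qed.

Lemma erase_core C x c h : C c -> core C c h ->
  erase C x h = canon (shape C c) (gact c^-1 x) (c^-1 * h)%g.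
Proof.
move=> Cc ch; rewrite /erase.
have : [set c | C c /\ core C c h] c by [].
move=> /(xgetI 1%g); set d := xget _ _ => -[Cd dh].
by rewrite (_ : d = c) ?asboolT//; apply: core_uniq ch Cd (core_tile dh).
Qed.

Lemma erase_out C x h : (forall c, C c -> ~ core C c h) -> erase C x h = x h.
Proof. by move=> nc; rewrite /erase asboolF// => -[/nc]. Qed.

Lemma core_translate C C' g c h : (forall k, C' k <-> C (g^-1 * k)%g) ->
  core C' (g * c)%g (g * h)%g <-> core C c h.
Proof.
move=> CC; split=> H b bB; have [H1 H2] := H b bB; split.
- by move: H1; rewrite invgM -!mulgA mulKg.
- move=> c' Cc' cc; have : C' (g * c')%g by apply/CC; rewrite mulKg.
  move=> /H2; rewrite invgM -!mulgA mulKg; apply.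
  by move/mulgI.
- by rewrite invgM -!mulgA mulKg.
- move=> c' /CC Cc' cc; have := H2 _ Cc'; rewrite invgM invgK -!mulgA; apply.
  by move=> gc; apply: cc; rewrite -gc mulVKg.
Qed.

Lemma erase_translate C C' g x : (forall k, C' k <-> C (g^-1 * k)%g) ->
  erase C' (gact g x) = gact g (erase C x).
Proof.
move=> CC; apply/funext => h; rewrite {2}/gact.
have [[c [Cc ch]]|nc] := pselect (exists c, C c /\ core C c (g^-1 * h)%g); last first.
  rewrite !erase_out//; first by move=> c Cc ch; apply: nc; exists c.
  move=> c /CC Cc ch; apply: nc; exists (g^-1 * c)%g; split => //.
  by apply/(core_translate _ _ CC); rewrite !mulVKg.
rewrite (erase_core x Cc ch) (@erase_core C' _ (g * c)%g).
- rewrite invgM -mulgA (_ : shape C' _ = shape C c).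
    congr (canon _ _ _); apply/funext => k; rewrite /gact !invgM !invgK.
    by rewrite -!mulgA mulKg.
  apply/seteqP; split => f; rewrite /shape /= -mulgA.
    by move/(core_translate _ _ CC).
  by move=> ?; apply/(core_translate _ _ CC).
- by apply/CC; rewrite mulKg.
- by rewrite -[h](mulVKg g); apply/(core_translate _ _ CC).
Qed.

(** A core can only shrink when markers are added, so one inclusion suffices, and only for markers
    whose tiles meet [h B]. *)
Lemma core_local C C' (E : {fset G}) c h : h \in E ->
  (forall k, k \in fmul E (fmul B (fsinv F)) -> C k -> C' k) ->
  core C' c h -> core C c h.
Proof.
move=> hE CC ch b bB; have [H1 H2] := ch b bB; split => // c' Cc' cc.
apply/negP => cF.
suff cE : c' \in fmul E (fmul B (fsinv F)) by have /negP := H2 c' (CC c' cE Cc') cc.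
apply/fmulP; exists h => //; apply/fmulP; exists b => //.
by rewrite in_fsinv !invgM !invgK -mulgA.
Qed.

(** Agreement of [x] and [x'] is needed only off the cores, because [canon] reads only the rest of
    the tile. This serves both continuity and counting. *)
Lemma erase_local C C' x x' (E : {fset G}) h : h \in E ->
  (forall c, C c -> (c^-1 * h)%g \in F -> (lcos c F `<=` E)%fset) ->
  (forall k, k \in fmul E (fmul B (fsinv F)) -> C k <-> C' k) ->
  (forall k, k \in E -> (forall c, C c -> ~ core C c k) -> x k = x' k) ->
  erase C x h = erase C' x' h.
Proof.
move=> hE tE CC xx.
have cl k c : k \in E -> core C c k <-> core C' c k.
  by move=> kE; split; apply: core_local kE _ => l /CC[].
have cE k c : k \in E -> core C' c k -> c \in fmul E (fmul B (fsinv F)).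
  move=> kE /core_tile ck; apply/fmulP; exists k => //; apply/fmulP; exists 1%g => //.
  by rewrite in_fsinv invg1 mul1g invgM invgK.
have [[c [Cc ch]]|nc] := pselect (exists c, C c /\ core C c h); last first.
  rewrite !erase_out; first by apply: xx => // c Cc ch; apply: nc; exists c.
    move=> c Cc ch; apply: nc; exists c; split; last exact/cl.
    by apply/CC => //; exact: cE hE ch.
  by move=> c Cc ch; apply: nc; exists c.
have ch' : core C' c h by apply/cl.
have Cc' : C' c by apply/CC => //; exact: cE hE ch'.
have /fsubsetP cFE := tE c Cc (core_tile ch).
have fE f : f \in F -> (c * f)%g \in E by move=> fF; apply: cFE; rewrite in_lcos mulKg.
rewrite (erase_core x Cc ch) (erase_core x' Cc' ch').
have -> : shape C' c = shape C c.
  apply/seteqP; split => f cf; have := core_tile cf; rewrite mulKg => /fE cfE.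
    by apply/(cl (c * f)%g).
  by apply/(cl (c * f)%g).
rewrite (@eq_canon (shape C c) (gact c^-1 x) (gact c^-1 x'))// => f fF Wf.
rewrite /gact invgK; apply: xx; first exact: fE.
(* A point of the tile of [c] in the core of [c'] forces [c' = c]. *)
move=> c' Cc1 cf; apply: Wf; rewrite /shape /=.
by rewrite {1}(core_uniq cf Cc _) ?mulKg.
Qed.

(** If [K] meets the core of [c], the [B]-margin puts all of [K] inside that tile and off the
    others, so one translated canonical extension gives the pattern. Otherwise [x] is unchanged on
    [K]. *)
Lemma erase_patterns C x (K : {fset G}) : X x ->
  (forall g x, X x -> X (gact g x)) ->
  (forall k l, k \in K -> l \in K -> (k^-1 * l)%g \in B) ->
  patterns X K (restr K (erase C x)).
Proof.
move=> Xx Xi KB.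
have [[c [k0 [Cc k0K ck]]]|nc] := pselect (exists c k, [/\ C c, k \in K & core C c k]); last first.
  exists x => //; apply/restrP => k kK; rewrite erase_out// => c Cc ck.
  by apply: nc; exists c, k.
have [Xv vx] := canonP (shape C c) (Xi c^-1%g x Xx).
exists (gact c (canon (shape C c) (gact c^-1 x))); first exact: Xi.
apply/restrP => k kK; rewrite {1}/gact.
have [cF cn] := ck _ (KB _ _ k0K kK); rewrite mulVKg in cF cn.
have [ck'|nck] := pselect (core C c k); first by rewrite (erase_core x Cc ck').
rewrite erase_out; last first.
  move=> d Cd dk; have [dc|dc] := pselect (d = c); first by apply: nck; rewrite -dc.
  by move: (cn d Cd dc); rewrite (core_tile dk).
rewrite vx//; first by rewrite /gact invgK mulVKg.
by rewrite /shape /= mulVKg.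
Qed.

End erase.

(** * The shift of erased configurations *)

Lemma config_compact (G : groupType) (A : finType) : compact [set: config G A].
Proof.
have := @tychonoff G (fun=> discrete_topology A) (fun=> setT)
  (fun=> @finite_compact (discrete_topology A) setT (@finite_finset A setT)).
by rewrite (_ : [set _ | _] = setT)//; apply/seteqP; split.
Qed.

Lemma config_hausdorff (G : groupType) (A : finType) : hausdorff_space (config G A).
Proof.
apply: (@hausdorff_product _ (fun=> discrete_topology A)) => g.
by apply: discrete_hausdorff.
Qed.

Section erased_shift.
Variables (G : groupType) (A : finType) (X : subshift G A) (Y : subshift G bool).
Variables (F B : {fset G}) (x0 : config G A).
Hypothesis B1 : 1%g \in B.

Let phi (z : config G (A * bool)%type) : config G A :=
  erase X F B x0 (marks (fun g => (z g).2)) (fun g => (z g).1).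

Let phi_continuous : continuous phi.
Proof.
move=> z W /config_nbhsP[K KW]; apply/config_nbhsP.
pose E := (K `|` fmul (fmul K (fsinv F)) F)%fset.
exists (E `|` fmul E (fmul B (fsinv F)))%fset => z' /restrP zz; apply: KW.
apply/restrP => k kK; apply: (erase_local X x0 B1 (E := E)) => //.
- by rewrite inE kK.
- move=> c _ ck; apply/fsubsetP => h; rewrite in_lcos => hF.
  rewrite inE; apply/orP; right; apply/fmulP; exists c => //.
  by apply/fmulP; exists k => //; rewrite in_fsinv invgM invgK.
- by move=> h hE; rewrite /marks /= zz// inE hE orbT.
- by move=> h hE _; rewrite zz// inE hE.
Qed.

Let phi_equivariant g z : phi (gact g z) = gact g (phi z).
Proof. exact: (erase_translate X F x0 B1). Qed.

Definition erased_set : set (config G A) :=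
  [set w | exists x y, [/\ shift_set X x, shift_set Y y & w = erase X F B x0 (marks y) x]].

Let erased_setE : erased_set = phi @` (prod_shift X Y).
Proof.
apply/seteqP; split => w.
  by move=> [x [y [Xx Yy ->]]]; exists (fun g => (x g, y g)).
move=> [z [Xz Yz] <-]; by exists (fun g => (z g).1), (fun g => (z g).2).
Qed.

Lemma erased_closed : closed erased_set.
Proof.
rewrite erased_setE; apply: compact_closed; first exact: config_hausdorff.
apply: continuous_compact.
  exact: continuous_subspaceT.
apply: (subclosed_compact _ (@config_compact G _)) => //.
exact: prod_set_closed.
Qed.

Lemma erased_invariant g w : erased_set w -> erased_set (gact g w).
Proof.
rewrite erased_setE => -[z Zz <-]; rewrite -phi_equivariant.
by exists (gact g z) => //; exact: (shift_invariant g Zz).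
Qed.

Definition erased_shift : subshift G A := Shift erased_closed erased_invariant.

Lemma erased_factor : is_factor (prod_shift X Y) erased_shift.
Proof.
exists phi; split; last by rewrite -erased_setE.
  exact: continuous_subspaceT.
by move=> g x _; exact: phi_equivariant.
Qed.

End erased_shift.

(** * Counting erased configurations *)

(** A Chernoff bound: weighting each [J] by [m^-|J|] gives total weight [(1 + 1/m)^|I|], of which
    every small set contributes at least [m^-N]. *)
Lemma ln_card_small_sets (R : realType) (I : finType) (N m : nat) : (0 < m)%N ->
  ln (#|[set i : {set I} | (#|i| <= N)%N]%SET|)%:R <=
    N%:R * ln m%:R + #|I|%:R / m%:R :> R.
Proof.
move=> m0; set Sm := [set i : {set I} | _]%SET.
have mR : 0 < m%:R :> R by rewrite ltr0n.
have S0 : 0 < #|Sm|%:R :> R.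
  by rewrite ltr0n; apply/card_gt0P; exists finset.set0; rewrite inE cards0.
pose t : R := m%:R^-1.
have t0 : 0 < t by rewrite invr_gt0.
have t1 : t <= 1 by rewrite invf_le1// ler1n.
have gen : (1 + t) ^+ #|I| = \sum_(J : {set I}) t ^+ #|J|.
  transitivity (\prod_(i : I) (t + 1)).
    by rewrite prodr_const addrC cardT.
  rewrite bigA_distr; apply: eq_bigr => J _.
  by rewrite -big_mkcond/= prodr_const.
have le : #|Sm|%:R * t ^+ N <= (1 + t) ^+ #|I|.
  rewrite gen (bigID (mem Sm))/= -[leLHS]addr0 lerD//; last first.
    by apply: sumr_ge0 => J _; rewrite exprn_ge0// ltW.
  rewrite mulr_natl -sumr_const; apply: ler_sum => J; rewrite inE => JN.
  by rewrite ler_wiXn2l// ltW.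
have : ln (#|Sm|%:R * t ^+ N) <= ln ((1 + t) ^+ #|I|).
  by rewrite ler_ln// posrE ?mulr_gt0 ?exprn_gt0// addr_gt0.
rewrite lnM ?posrE ?exprn_gt0// !lnXn ?addr_gt0// lnV ?posrE//.
rewrite mulNrn lerBlDl => /le_trans; apply; rewrite mulr_natl lerD2l mulr_natl.
rewrite ler_wMn2r// le_ln1Dx// (lt_le_trans _ (ltW t0))// ltrN10.
Qed.

Section single_cover.
Variables (G : groupType) (F : {fset G}).
Implicit Type D : {fset G}.
Local Open Scope nat_scope.
Local Open Scope fset_scope.

Definition once D := [fset h in fmul D F | `[< forall c c', c \in D -> c' \in D ->
  (c^-1 * h)%g \in F -> (c'^-1 * h)%g \in F -> c = c' >]].

(** Among the [|D| |F|] incidences of points with tiles, a point of [fmul D F] outside [once D]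
    accounts for at least two. *)
Lemma card_once D : 2 * #|` fmul D F| <= #|` D| * #|` F| + #|` once D|.
Proof.
elim/fset1U_rect: D => [|d D dD IH].
  rewrite (_ : fmul _ _ = fset0) ?cardfs0//.
  by apply/fsetP => h; rewrite inE; apply/fmulP => -[d]; rewrite inE.
have sub : (once D `\` lcos d F) `|` (lcos d F `\` fmul D F) `<=` once (d |` D).
  apply/fsubsetP => h; rewrite !inE/= fmul_fsetU1 inE => /orP[].
    move=> /andP[hd /andP[-> /asboolP hD]]; rewrite orbT; apply/asboolP => c c'.
    rewrite in_lcos in hd.
    rewrite !inE => /predU1P[->|cD] /predU1P[->|cD']//; try by rewrite (negbTE hd).
    exact: hD.
  move=> /andP[hD hd]; rewrite hd/=; apply/asboolP => c c'.
  have nD x : x \in D -> (x^-1 * h)%g \in F -> False.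
    by move=> xD xF; move/negP: hD; apply; apply/fmulP; exists x.
  by rewrite !inE => /predU1P[->|cD] /predU1P[->|cD']// cF cF';
    [case: (nD c')|case: (nD c)|case: (nD c)].
have := fsubset_leq_card sub; rewrite cardfsU (_ : _ `&` _ = fset0) ?cardfs0 ?subn0; last first.
  by apply/fsetP => h; rewrite !inE; case: (h \in lcos d F); rewrite ?andbF.
rewrite fmul_fsetU1 cardfsU1 dD.
have : #|` once D `&` lcos d F| <= #|` lcos d F `&` fmul D F|.
  by apply: fsubset_leq_card; apply/fsubsetP => h; rewrite !inE/= => /andP[/andP[-> _] ->].
have := cardfsID (lcos d F) (once D); have := cardfsID (fmul D F) (lcos d F).
have := cardfsUI (lcos d F) (fmul D F); rewrite card_lcos mulnDl mul1n.
by move: IH; lia.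
Qed.

End single_cover.

Section windows.
Variables (G : groupType) (F V B L E : {fset G}).
Local Open Scope fset_scope.

(* [inner] contains every tile meeting [E], [middle] every marker that can
   influence the erasure inside [inner], [outer] the tiles at these markers. *)
Definition inner := fmul E (1%g |` (fmul (fsinv F) F `|` (L `|` fmul V (fsinv V)))).
Definition middle := fmul inner (1%g |` fmul B (fsinv F)).
Definition outer := fmul middle (1%g |` (F `|` (V `|` fsinv L))).

Definition uncored (C : set G) :=
  [fset h in inner | `[< forall c, C c -> ~ core F B C c h >]].

(** As [E] times a fixed finite set, [outer] is hardly larger than a sufficiently invariant [E]. *)
Lemma outerE : outer = fmul E (fmul (1%g |` (fmul (fsinv F) F `|` (L `|` fmul V (fsinv V))))
  (fmul (1%g |` fmul B (fsinv F)) (1%g |` (F `|` (V `|` fsinv L))))).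
Proof. by rewrite /outer /middle /inner !fmulA. Qed.

End windows.

(** * Sizes of the erased and retained regions *)

Section erased_counts.
Variables (G : groupType) (F V B L E : {fset G}) (M : nat).
Variable (C : set G).
Hypotheses (V0 : V != fset0) (B1 : 1%g \in B).
Hypotheses (cV : #|` V| = (M * #|` F|)%N)
  (VF : forall D, (#|` fmul D V| <= M * #|` fmul D F|)%N).
Hypotheses (Cs : sparse V C) (Cd : forall g, dense_at V C g).
Local Open Scope nat_scope.
Local Open Scope fset_scope.

Let M0 : 0 < M.
Proof. by move: V0; rewrite -cardfs_gt0 cV muln_gt0 => /andP[]. Qed.

Let small D : ([set` D] `<=` C)%classic -> 3 * (#|` D| * #|` F|) <= 4 * #|` fmul D F|.
Proof.
move=> /Cs; rewrite cV => le; rewrite -(leq_pmul2l M0).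
by have := VF D; move: le; move: #|` D| #|` F| #|` fmul D V| #|` fmul D F| => d f v w; nia.
Qed.

(** Tiles meeting [E] have markers in [E F^-1], whose number sparseness bounds through
    [|V| = M |F|]: the tiles [c F] have density of order [1 / M]. *)
Lemma card_covered :
  3 * (M * #|` [fset h in E | `[< covered F C h >]]|) <=
    4 * #|` fmul (fmul E (fsinv F)) V|.
Proof.
pose D := [fset c in fmul E (fsinv F) | `[< C c >]].
have DC : ([set` D] `<=` C)%classic by move=> c /=; rewrite !inE => /andP[_ /asboolP].
have DE : D `<=` fmul E (fsinv F) by apply/fsubsetP => c; rewrite !inE => /andP[].
apply: leq_trans (sparse_card Cs DC DE).
rewrite leq_mul2l/= cV mulnCA leq_mul2l; apply/orP; right.
apply: leq_trans (card_fmul _ _); apply: fsubset_leq_card; apply/fsubsetP => h.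
rewrite !inE/= => /andP[hE /asboolP[v vF Cv]].
apply/fmulP; exists (h * v^-1)%g; last by rewrite invgM invgK mulgVK.
by rewrite !inE/= mem_fmul ?in_fsinv ?invgK//; apply/asboolP.
Qed.

Let E2 := inner F V L E.
Let E1 := middle F V B L E.
Let E' := outer F V B L E.
Local Notation uncored := (uncored F V B L E C).

Let D := [fset c in E1 | `[< C c >]].
Let W := [fset h in E2 | `[< exists2 c, C c & core F B C c h >]].
Let beta := #|` fbd (B `|` fmul L B) F|.

Let EE2 : E `<=` E2. Proof. by apply: fsub_fmul1; rewrite fset1U1. Qed.
Let E2E1 : E2 `<=` E1. Proof. by apply: fsub_fmul1; rewrite fset1U1. Qed.
Let E1E' : E1 `<=` E'. Proof. by apply: fsub_fmul1; rewrite fset1U1. Qed.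

Let DC : ([set` D] `<=` C)%classic.
Proof. by move=> c /=; rewrite !inE => /andP[_ /asboolP]. Qed.

Let DE1 : D `<=` E1.
Proof. by apply/fsubsetP => c; rewrite !inE => /andP[]. Qed.

Let memD h b c : h \in E2 -> b \in B -> C c -> (c^-1 * (h * b))%g \in F -> c \in D.
Proof.
move=> hE bB Cc cF; rewrite !inE/=; apply/andP; split; last exact/asboolP.
apply/fmulP; exists h => //; apply/fset1Ur/fmulP; exists b => //.
by rewrite in_fsinv !invgM !invgK -mulgA.
Qed.

(** A point covered once but in no core is outside [inner] or close to the boundary of some tile,
    its own or another. *)
Let card_core : 2 * #|` fmul D F| <=
  #|` D| * #|` F| + (#|` W| + (#|` E'| - #|` E2|) + #|` D| * beta).
Proof.
apply: leq_trans (card_once F D) _; rewrite leq_add2l.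
have sub : once F D `<=` W `|` (E' `\` E2) `|` fmul D (fbd (B `|` fmul L B) F).
  apply/fsubsetP => h; rewrite !inE/= => /andP[hDF /asboolP h1].
  have [hE2|hE2] /= := boolP (h \in E2); last first.
    apply/orP; left; move: h hDF {h1 hE2}; apply/fsubsetP.
    by apply: fmulSS => //; apply/fsubsetP => f fF; rewrite !inE fF orbT.
  rewrite orbF; case: asboolP => //= nh.
  have [c cD cF] := fmulP _ _ _ hDF.
  have : ~ core F B C c h by move=> ch; apply: nh; exists c => //; exact: DC.
  move=> /existsNP[b /not_implyP[bB /not_andP[]]].
    move=> /negP cb; apply/fmulP; exists c => //; apply/fbdP; split.
      by exists 1%g; rewrite ?mulg1// inE B1.
    by exists b; rewrite ?inE ?bB// -mulgA.
  (* Some [h b] lies in another tile; [h] itself does not, being covered once, so it is a boundary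
     point for that tile. *)
  move=> /existsNP[c' /not_implyP[Cc' /not_implyP[cc /negP/negPn cF']]].
  have cD' := memD hE2 bB Cc' cF'.
  apply/fmulP; exists c' => //; apply/fbdP; split.
    by exists b; rewrite ?inE ?bB// -mulgA.
  exists 1%g; rewrite ?mulg1 ?inE ?B1//; apply/negP => cF1.
  by apply: cc; apply: h1.
apply: leq_trans (fsubset_leq_card sub) _.
apply: leq_trans (leq_card_fsetU _ _).1 _; apply: leq_add; last exact: card_fmul.
apply: leq_trans (leq_card_fsetU _ _).1 _; rewrite leq_add2l.
by rewrite cardfsDS//; exact: fsubset_trans E2E1 E1E'.
Qed.

Let card_W : #|` E2| = (#|` W| + #|` uncored|)%N.
Proof.
rewrite -(cardfsID W E2); congr addn.
  by congr #|` _|; apply/fsetIidPr/fsubsetP => h; rewrite !inE => /andP[].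
congr #|` _|; apply/fsetP => h; rewrite !inE/=; case: (h \in E2) => //=.
rewrite andbT; apply/negP/asboolP => [nW c Cc ch|nW /asboolP[c Cc /(nW c Cc)]//].
by apply: nW; apply/asboolP; exists c.
Qed.

(** If [g L] has points in and out of the core of [c], a failing point [g l b] shows that [g] is
    close to the boundary of the tile of [c] or of another; hence [L B] in the boundary set. *)
Let card_fbd_uncored : #|` fbd L uncored| <= (#|` E'| - #|` E|) + #|` D| * beta.
Proof.
have sub : fbd L uncored `<=` (E' `\` E) `|` fmul D (fbd (B `|` fmul L B) F).
  apply/fsubsetP => g /fbdP[[l lL]]; rewrite !inE/= => /andP[lE /asboolP ln].
  move=> [l' lL' lE']; have [gE|gE] := boolP (g \in E); last first.
    apply/orP; left; apply/andP; split=> //; apply/fmulP; exists (g * l)%g.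
      exact: (fsubsetP E2E1).
    by rewrite invgM mulgVK !inE in_fsinv invgK lL !orbT.
  have gl' : (g * l')%g \in E2 by apply: mem_fmul => //; rewrite !inE lL' !orbT.
  move: lE'; rewrite !inE/= gl'/= => /asboolPn /existsNP[c /not_implyP[Cc /contrapT cl']].
  have cD : c \in D by apply: (memD gl' B1 Cc); rewrite mulg1; exact: core_tile cl'.
  have := ln c Cc; move=> /existsNP[b /not_implyP[bB /not_andP[]]].
    move=> /negP cb; apply/fmulP; exists c => //; apply/fbdP; split.
      exists l'; last by rewrite -mulgA; exact: core_tile cl'.
      by rewrite inE; apply/orP; right; rewrite -[l']mulg1 mem_fmul.
    by exists (l * b)%g; rewrite ?inE ?mem_fmul ?orbT// -mulgA [(g * (l * b))%g]mulgA.
  move=> /existsNP[c' /not_implyP[Cc' /not_implyP[cc /negP/negPn cF']]].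
  have cD' := memD lE bB Cc' cF'.
  apply/fmulP; exists c' => //; apply/fbdP; split.
    by exists (l * b)%g; rewrite ?inE ?mem_fmul ?orbT// -mulgA [(g * (l * b))%g]mulgA.
  exists l'; first by rewrite inE; apply/orP; right; rewrite -[l']mulg1 mem_fmul.
  have [_ /(_ c' Cc' cc)] := cl' _ B1; by rewrite mulg1 -mulgA.
apply: leq_trans (fsubset_leq_card sub) _.
apply: leq_trans (leq_card_fsetU _ _).1 _; apply: leq_add; last exact: card_fmul.
by rewrite cardfsDS//; apply: fsubset_trans EE2 (fsubset_trans E2E1 E1E').
Qed.

Let card_V_upper : 3 * (#|` D| * #|` V|) <= 4 * #|` E'|.
Proof.
apply: leq_trans (sparse_card Cs DC DE1) _; rewrite leq_mul2l/=.
apply: fsubset_leq_card; apply: fmulSS => //.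
by apply/fsubsetP => v vV; rewrite !inE vV !orbT.
Qed.

Let card_V_lower : #|` E| <= 4 * (#|` D| * #|` V|).
Proof.
apply: leq_trans (dense_card V0 E Cd) _; rewrite leq_mul2l/= leq_mul2r; apply/orP; right.
apply: fsubset_leq_card; apply/fsubsetP => h; rewrite !inE/= => /andP[hE ->].
rewrite andbT; apply: (fsubsetP E2E1); move: h hE; apply/fsubsetP; apply: fmulSS => //.
by apply/fsubsetP => v vV; rewrite !inE vV !orbT.
Qed.

(** By sparseness [D F] has at least [3/4 d |F|] points, so [card_core] puts about [d |F| / 2]
    points into cores. With [outer] close to [E], the last clause bounds the retained region and its
    [L]-boundary by about [|E| - d |F| / 2]. *)
Lemma uncored_counts : exists d : nat,
  [/\ #|` [fset c in middle F V B L E | `[< C c >]]| = d,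
    3 * (d * #|` V|) <= 4 * #|` outer F V B L E|, #|` E| <= 4 * (d * #|` V|) &
    2 * (#|` uncored| + #|` fbd L uncored|) + d * #|` F| + 4 * #|` E| <=
      6 * #|` outer F V B L E| + 4 * (d * #|` fbd (B `|` fmul L B) F|)].
Proof.
exists #|` D|; split => //.
have := small DC; have := card_core; have := card_fbd_uncored; have := card_W.
have := fsubset_leq_card EE2; have := fsubset_leq_card E2E1; have := fsubset_leq_card E1E'.
rewrite -/beta -/E'; move: (#|` D| * #|` F|) (#|` D| * beta) => x y.
move: #|` fmul D F| #|` E'| #|` E| #|` E1| #|` E2| #|` W| #|` uncored| #|` fbd _ _|.
move=> a b c d e f g h; lia.
Qed.

End erased_counts.

(** * Patterns and entropy kept by erasing *)

Section erased_shift_entropy.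
Variables (R : realType) (G : groupType) (S : {fset G}) (A : finType).
Variables (X : subshift G A) (F V B : {fset G}) (M : nat) (x0 : config G A).
Hypotheses (gen : generating S) (am : amenable R S).
Hypotheses (V0 : V != fset0) (B1 : 1%g \in B).
Hypotheses (cV : #|` V| = (M * #|` F|)%N)
  (VF : forall D, (#|` fmul D V| <= M * #|` fmul D F|)%N).
Hypothesis Xx0 : shift_set X x0.

Let Z := erased_shift X (marker_shift V) F x0 B1.

Let X0 : (X : set (config G A)) !=set0.
Proof. by exists x0. Qed.

Lemma erased_shift_neq0 : (Z : set (config G A)) !=set0.
Proof.
have [y Yy] := marker_shift_neq0 V0.
by exists (erase X F B x0 (marks y) x0), x0, y.
Qed.

(** For fixed markers erasing changes [x] only inside tiles, so the erased pattern and the letters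
    on [U] recover [x] on [E]. *)
Lemma erased_npat_ge (y : config G bool) (E : {fset G}) : shift_set (marker_shift V) y ->
  (npat X E <= npat Z E * #|A| ^ #|` [fset h in E | `[< covered F (marks y) h >]]%fset|)%N.
Proof.
move=> Yy; set U := [fset h in E | _]%fset.
pose P (i : {ffun U -> A}) : set (config G A) := [set x | shift_set X x /\ restr U x = i].
apply: (@leq_trans (\sum_i npat (P i) E)).
  by apply: npat_bigcup => x Xx; exists (restr U x).
apply: (@leq_trans (\sum_(i : {ffun U -> A}) npat Z E)); last first.
  by rewrite sum_nat_const card_ffun mulnC cardfE.
apply: leq_sum => i _.
apply: (npat_le (r := fun z x => z = erase X F B x0 (marks y) x)).
  by move=> x [Xx _]; exists (erase X F B x0 (marks y) x) => //; exists x, y.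
move=> _ _ x x' _ _ [Xx xi] [Xx' xi'] -> -> /restrP ee; apply/restrP => k kE.
have [kU|kU] := boolP (k \in U).
  by move: k kU {kE}; apply/restrP; rewrite xi xi'.
have nc c : marks y c -> ~ core F B (marks y) c k.
  move=> Cc /(core_tile B1) cF; move/negP: kU; apply; rewrite !inE kE /=.
  by apply/asboolP; exists (c^-1 * k)%g => //; rewrite invgM invgK mulVKg.
by have := ee k kE; rewrite !erase_out.
Qed.

Lemma erased_patterns (K : {fset G}) :
  (3 * #|` K| < M)%N -> (forall k l, k \in K -> l \in K -> (k^-1 * l)%g \in B) ->
  patterns Z K = patterns X K.
Proof.
move=> MK KB; apply/seteqP; split => [_ [z [x [y [Xx Yy ->]]] <-]|p [x Xx <-]].
  by apply: erase_patterns => // g w; exact: shift_invariant.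
have [y Yy] := marker_shift_neq0 V0.
pose C := marks y.
have [g gK] : exists g, forall k, k \in K -> ~ covered F C (g * k)%g.
  pose Q := fmul K (fmul (fsinv F) V).
  have [E E0 EQ] := invariant_fset_fmul gen Q am (@ltr01 R).
  (* If every [g K] met a tile, then [|E| <= |K| |U|], while [card_covered] gives
     [3 M |U| <= 8 |E|]; this contradicts [M > 3 |K|]. *)
  apply: contrapT => /forallNP bad.
  pose U := [fset h in fmul E K | `[< covered F C h >]]%fset.
  have EU : (E `<=` fmul U (fsinv K))%fset.
    apply/fsubsetP => g gE; have := bad g.
    move=> /existsNP[k /not_implyP[kK /contrapT gk]].
    apply/fmulP; exists (g * k)%g; last by rewrite in_fsinv invgM invgK mulKg.
    by rewrite !inE/= mem_fmul//; apply/asboolP.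
  have le1 := card_covered (fmul E K) cV (proj1 Yy).
  have le2 := leq_trans (fsubset_leq_card EU) (card_fmul _ _).
  have Kinv : #|` fsinv K| = #|` K| by apply: card_imfset => a b /invg_inj.
  rewrite -!fmulA -/Q -/U in le1; rewrite Kinv in le2.
  have E1 : (0 < #|` E|)%N by rewrite cardfs_gt0.
  have EQ2 : (#|` fmul E Q| <= 2 * #|` E|)%N.
    by rewrite -(ler_nat R) natrM; apply: le_trans EQ _; rewrite ler_wpM2r//.
  move: MK le1 le2 E1 EQ2.
  move: #|` K| #|` U| #|` E| #|` fmul E Q| => k u e q; clear; nia.
(* Move the pattern to the tile-free window [g K], erase, and move back. *)
exists (gact g^-1 (erase X F B x0 C (gact g x))).
  apply: (shift_invariant (s := Z)); exists (gact g x), y; split => //.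
  exact: shift_invariant.
apply/restrP => k kK; rewrite /gact invgK erase_out ?mulKg// => c Cc ck.
apply: (gK k kK); exists (c^-1 * (g * k))%g; first exact: core_tile ck.
by rewrite invgM invgK mulVKg.
Qed.

Lemma erased_entropy_ge :
  entropy_inf R X <= entropy_inf R Z + 3 / M%:R * ln #|A|%:R.
Proof.
have [y Yy] := marker_shift_neq0 V0.
have [Fo FS] := am.
have Fp n : 0 < #|` Fo n|%:R :> R by rewrite ltr0n cardfs_gt0; case: FS.
have F0n n : Fo n != fset0 by case: FS.
have Z0 := erased_shift_neq0.
have A0 : 0 < #|A|%:R :> R by rewrite ltr0n; apply/card_gt0P; exists (x0 1%g).
have M0 : 0 < M%:R :> R.
  by rewrite ltr0n; move: V0; rewrite -cardfs_gt0 cV muln_gt0 => /andP[].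
have a0 : 0 <= ln #|A|%:R :> R by rewrite ln_ge0// ler1n -(ltr0n R).
have cvg : ln (npat Z (Fo n))%:R / #|` Fo n|%:R + 3 / M%:R * ln #|A|%:R @[n --> \oo] -->
    entropy_inf R Z + 3 / M%:R * ln #|A|%:R.
  by apply: cvgD; [exact: rate_cvg|exact: cvg_cst].
apply: (cvgr_to_ge cvg).
(* Invariance up to a factor 2 gives [|U| <= 8 |E| / (3 M)], and 8/3 is rounded up to 3. *)
apply: filterS (folner_fmul gen (fmul (fsinv F) V) FS (@ltr01 R)) => n.
set E := Fo n => EQ.
have := card_covered E cV (proj1 Yy); rewrite -fmulA.
have := erased_npat_ge E Yy; set U := [fset h in E | _]%fset => leZ leU.
have h1 := entropy_inf_le R X0 (F0n n).
have posX : 0 < (npat X E)%:R :> R by rewrite ltr0n npat_gt0.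
have posZ : 0 < (npat Z E)%:R :> R by rewrite ltr0n npat_gt0.
have {}leZ : ln (npat X E)%:R <= ln (npat Z E)%:R + #|` U|%:R * ln #|A|%:R :> R.
  rewrite mulr_natl -lnXn// -lnM ?posrE ?exprn_gt0//.
  by rewrite ler_ln ?posrE ?mulr_gt0 ?exprn_gt0// -natrX -natrM ler_nat.
apply: le_trans h1 _; rewrite -/E ler_pdivrMr; last exact: Fp.
apply: le_trans leZ _; rewrite mulrDl divfK ?gt_eqF ?Fp// lerD2l mulrAC.
rewrite ler_wpM2r// mulrAC ler_pdivlMr//.
have {}leU : 3 * (M%:R * #|` U|%:R) <= 4 * #|` fmul E (fmul (fsinv F) V)|%:R :> R.
  by rewrite -!natrM ler_nat.
have := ltW (Fp n); rewrite -/E; lra.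
Qed.

End erased_shift_entropy.

(** * Upper bound for patterns of the erased shift *)

Section erased_shift_upper.
Variables (R : realType) (G : groupType) (A : finType).
Variables (X : subshift G A) (F V B L E : {fset G}) (x0 : config G A).
Hypothesis B1 : 1%g \in B.

Let Z := erased_shift X (marker_shift V) F x0 B1.
Let mid := middle F V B L E.

(** Split by the trace of the markers on [mid]. For a given trace, [erase_local] recovers the erased
    pattern from [x] on the uncored region. *)
Lemma erased_npat_le (N : nat) (b : R) : 0 <= b ->
  (forall y, shift_set (marker_shift V) y ->
     (#|` [fset c in mid | `[< marks y c >]]%fset| <= N)%N) ->
  (forall y, shift_set (marker_shift V) y ->
     (npat X (uncored F V B L E (marks y)))%:R <= b) ->
  (npat Z E)%:R <= #|[set i : {set mid} | (#|i| <= N)%N]%SET|%:R * b.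
Proof.
move=> b0 yN yb.
pose I (y : config G bool) := [set c : mid | `[< marks y (val c) >]]%SET.
pose P (i : {set mid}) : set (config G A) := [set z | exists x y,
  [/\ shift_set X x, shift_set (marker_shift V) y, i = I y & z = erase X F B x0 (marks y) x]].
have same y y' c : I y = I y' -> c \in mid -> marks y c -> marks y' c.
  move=> /setP yy cm yc; have := yy [` cm]%fset.
  by rewrite !inE/= (asboolT yc) => /esym/asboolP.
apply: (@le_trans _ _ (\sum_i (npat (P i) E)%:R)).
  rewrite -natr_sum ler_nat; apply: npat_bigcup => z [x [y [Xx Yy ->]]].
  by exists (I y), x, y.
have middleP k : k \in inner F V L E -> {subset fmul (inner F V L E) (fmul B (fsinv F)) <= mid}.
  move=> _; apply/fsubsetP; apply: fmulSS => //; exact: fsubsetU1.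
rewrite -sum1_card natr_sum mulr_suml [leRHS]big_mkcond; apply: ler_sum => i _.
have [->|/set0P[_ [x1 [y1 [_ Yy1 iy1 _]]]]] := eqVneq (P i) set0.
  by rewrite npat_set0; case: ifP; rewrite ?mul1r.
rewrite inE iy1 [#|I y1|](card_sub_fset _ (fun c => `[< marks y1 c >])) yN// mul1r.
(* Markings with the same trace have the same cores inside [inner], so the region of [y1] serves for
   all of them. *)
apply: le_trans (yb y1 Yy1); rewrite ler_nat.
apply: (npat_le (r := fun x z => exists y, I y1 = I y /\ z = erase X F B x0 (marks y) x)).
  by move=> z [x [y [Xx Yy yy ->]]]; exists x => //; exists y.
move=> x x' _ _ _ _ _ _ [y [yy ->]] [y' [yy' ->]] /restrP xx.
apply/restrP => h hE.
have hin : h \in inner F V L E by apply: (fsubsetP (fsub_fmul1 _ _)) hE; rewrite fset1U1.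
apply: (erase_local X x0 B1 (E := inner F V L E)) => //.
- move=> c _ ch; apply/fsubsetP => k; rewrite in_lcos => ck.
  apply/fmulP; exists h => //; rewrite !inE; apply/orP; right; apply/orP; left.
  apply/fmulP; exists (h^-1 * c)%g; first by rewrite in_fsinv invgM invgK.
  by rewrite invgM invgK -mulgA mulVKg.
- move=> k /(middleP h hin) kmid; split; apply: same => //.
    by rewrite -yy -yy'.
  by rewrite -yy -yy'.
- move=> k kin nc; apply: xx; rewrite !inE kin /=; apply/asboolP => c Cc ck.
  have cmid : c \in mid.
    apply: (middleP k kin); apply/fmulP; exists k => //; apply/fmulP; exists 1%g => //.
    by rewrite in_fsinv invg1 mul1g invgM invgK; exact: core_tile ck.
  apply: (nc c); first exact: same Cc.
  by apply: (core_local kin _ ck) => l /(middleP k kin) lmid; apply: same.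
Qed.

End erased_shift_upper.

(** * The erased shift differs from the original *)

Section erasure_strict.
Variables (R : realType) (G : groupType) (S : {fset G}) (A : finType).
Variables (X : subshift G A) (B : {fset G}) (M : nat).
Hypotheses (gen : generating S) (am : amenable R S) (inf : infinite_set [set: G]).
Hypotheses (B1 : 1%g \in B) (M0 : (0 < M)%N).
Hypothesis X0 : (X : set (config G A)) !=set0.
Hypothesis h0 : 0 < entropy_inf R X.

Let h := entropy_inf R X.
(* The erased region has density at least [2 * s], since there is at least one
   marker per [4 * |V|] elements and each erases about half of its tile. *)
Let s : R := (32 * M%:R)^-1.

Let MR : 0 < M%:R :> R. Proof. by rewrite ltr0n. Qed.
Let s0 : 0 < s. Proof. by rewrite invr_gt0 mulr_gt0. Qed.
Let Ms : 32 * M%:R * s = 1. Proof. by rewrite mulfV// gt_eqF// mulr_gt0. Qed.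

Let s1 : 32 * s <= 1.
Proof.
have M1 : 1 <= M%:R :> R by rewrite ler1n.
by have := Ms; have := s0; nra.
Qed.

Lemma erased_shift_neq : exists F V : {fset G},
  [/\ V != fset0, #|` V| = (M * #|` F|)%N,
    forall D, (#|` fmul D V| <= M * #|` fmul D F|)%N &
    forall x0, shift_set X x0 -> erased_shift X (marker_shift V) F x0 B1 <> X].
Proof.
have hs0 : 0 < h * s by rewrite mulr_gt0.
have [L L0] := entropy_inf_lt X0 hs0; rewrite -/h => rateL.
have Lp : 0 < #|` L|%:R :> R by rewrite ltr0n cardfs_gt0.
(* The parameter of [ln_card_small_sets]: its second term will be at most [|E| h s / 4]. *)
pose m := (Num.bound (8 / (h * s))).+1.
have mR : 0 < m%:R :> R by rewrite ltr0n.
have m2 : 2 / m%:R <= h * s / 4.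
  have : 8 / (h * s) <= m%:R.
    apply/ltW; apply: lt_trans (archi_boundP _) _; first by rewrite divr_ge0// ltW.
    by rewrite ltr_nat.
  rewrite !ler_pdivrMr// => mle; lra.
have lnm : 0 <= ln m%:R :> R by rewrite ln_ge0// ler1n.
(* A large tile makes markers rare: with [N |F| <= 96 s |E|] below, [384 = 4 * 96] yields
   [N ln m <= |E| h s / 4]. *)
pose f0 := (Num.bound (384 * ln m%:R / h)).+1.
have [|F Ff Fbd] := invariant_fset_large gen (B `|` fmul L B)%fset f0 inf am (e := 16^-1).
  by rewrite invr_gt0 ltr0n/= invf_lt1// ltr1n.
have F0 : F != fset0 by rewrite -cardfs_gt0; apply: leq_trans Ff.
have Fp : 0 < #|` F|%:R :> R by rewrite ltr0n cardfs_gt0.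
have fle : 384 * ln m%:R <= h * #|` F|%:R :> R.
  rewrite [leRHS]mulrC -ler_pdivrMr//; apply/ltW.
  apply: lt_le_trans (archi_boundP _) _; first by rewrite divr_ge0 ?mulr_ge0// ltW.
  by rewrite ler_nat; apply: leq_trans Ff.
have [V [cV VF]] := spread_tile F M inf.
have Vp : (0 < #|` V|)%N by rewrite cV muln_gt0 M0 cardfs_gt0.
have V0 : V != fset0 by rewrite -cardfs_gt0.
exists F, V; split => // x0 Xx0 ZX.
(* The window error [6 (|outer| - |E|)] will be at most [2 s |E|]. *)
have s30 : 0 < s / 3 by rewrite divr_gt0.
have [E E0] := invariant_fset_fmul gen (fmul (1%g |` (fmul (fsinv F) F `|` (L `|` fmul V (fsinv V))))
  (fmul (1%g |` fmul B (fsinv F)) (1%g |` (F `|` (V `|` fsinv L)))))%fset am s30.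
rewrite -outerE => Ele.
have Ep : 0 < #|` E|%:R :> R by rewrite ltr0n cardfs_gt0.
have hE := entropy_inf_le R X0 E0; rewrite -/h ler_pdivlMr// in hE.
have E2 : #|` outer F V B L E|%:R <= 2 * #|` E|%:R :> R.
  by apply: le_trans Ele _; rewrite ler_pM2r//; have := s1; lra.
pose N := ((4 * #|` outer F V B L E|) %/ (3 * #|` V|))%N.
pose b : R := expR (#|` E|%:R * (h * (1 - s))).
have counts y : shift_set (marker_shift V) y ->
    (#|` [fset c in middle F V B L E | `[< marks y c >]]%fset| <= N)%N /\
    (npat X (uncored F V B L E (marks y)))%:R <= b.
  move=> [ys yd].
  have [d [-> dV Ed count]] := uncored_counts L E V0 B1 cV VF ys yd.
  split; first by rewrite /N leq_divRL ?muln_gt0// mulnCA.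
  set T := uncored _ _ _ _ _ _ in count *.
  have Tp : 0 < (npat X T)%:R :> R by rewrite ltr0n npat_gt0.
  rewrite -[leLHS]lnK ?posrE// ler_expR.
  set t := (#|` T| + #|` fbd L T|)%N in count.
  have lnT : ln (npat X T)%:R <= t%:R * (ln (npat X L)%:R / #|` L|%:R) :> R.
    rewrite mulrA ler_pdivlMr// mulrC; exact: ln_npat_le.
  (* The gain [d |F| / 2] less the boundary loss [d |F| / 8] is at least [3 s |E|]; the window error
     uses up [s |E|] of it. *)
  have tle : t%:R <= #|` E|%:R * (1 - 2 * s).
    have dF : d%:R * #|` fbd (B `|` fmul L B)%fset F|%:R <= d%:R * #|` F|%:R / 16 :> R.
      by rewrite -mulrA ler_wpM2l// mulrC.
    have Es : 8 * s * #|` E|%:R <= d%:R * #|` F|%:R.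
      move: Ed; rewrite -(ler_nat R) cV !natrM => Ed.
      have Ed' : s * #|` E|%:R <= s * (4 * (d%:R * (M%:R * #|` F|%:R))) by rewrite ler_pM2l.
      have -> : d%:R * #|` F|%:R = 32 * M%:R * s * (d%:R * #|` F|%:R) :> R by rewrite Ms mul1r.
      lra.
    move: count Ele; rewrite -(ler_nat R) !natrD !natrM => count Ele; lra.
  apply: le_trans lnT _.
  (* Here [(1 - 2 s)(1 + s) <= 1 - s]. *)
  apply: (@le_trans _ _ ((#|` E|%:R * (1 - 2 * s)) * (h + h * s))).
    apply: ler_pM => //; last exact: ltW.
    by rewrite divr_ge0// ln_ge0// ler1n npat_gt0.
  rewrite -mulrA ler_wpM2l//; have := s0; have := hs0; nra.
have := @erased_npat_le R G A X F V B L E x0 B1 N b (expR_ge0 _)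
  (fun y Yy => proj1 (counts y Yy)) (fun y Yy => proj2 (counts y Yy)).
rewrite ZX; set c := #|_|%:R => le.
have EX : 0 < (npat X E)%:R :> R by rewrite ltr0n npat_gt0.
have c0 : 0 < c.
  by rewrite ltr0n; apply/card_gt0P; exists finset.set0; rewrite inE cards0.
have : ln (npat X E)%:R <= ln c + #|` E|%:R * (h * (1 - s)).
  by rewrite -[X in _ + X]expRK -/b -lnM ?posrE ?expR_gt0// ler_ln ?posrE ?mulr_gt0 ?expR_gt0.
have := @ln_card_small_sets R (middle F V B L E) N m (ltn0Sn _); rewrite -/c => lnc.
apply/negP; rewrite -ltNge.
apply: lt_le_trans hE.
have NV : N%:R * #|` V|%:R <= 3 * #|` E|%:R :> R.
  have : (N * (3 * #|` V|))%:R <= (4 * #|` outer F V B L E|)%:R :> R.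
    by rewrite ler_nat leq_trunc_div.
  rewrite !natrM => NV; lra.
have midE : #|{: middle F V B L E}|%:R <= 2 * #|` E|%:R :> R.
  apply: le_trans E2; rewrite -cardfE ler_nat; apply: fsubset_leq_card.
  by apply: fsub_fmul1; rewrite fset1U1.
have Nln : N%:R * ln m%:R <= #|` E|%:R * (h * s / 4).
  have Nf : N%:R * #|` F|%:R <= 96 * s * #|` E|%:R :> R.
    have -> : N%:R * #|` F|%:R = 32 * M%:R * s * (N%:R * #|` F|%:R) :> R by rewrite Ms mul1r.
    move: NV; rewrite cV natrM => NV.
    have : s * (N%:R * (M%:R * #|` F|%:R)) <= s * (3 * #|` E|%:R) by rewrite ler_pM2l.
    lra.
  have := ler_wpM2l (ler0n R N) fle.
  have := ler_wpM2l (ltW h0) Nf; rewrite -/h; lra.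
have mm : #|{: middle F V B L E}|%:R / m%:R <= #|` E|%:R * (h * s / 4).
  apply: (@le_trans _ _ (2 * #|` E|%:R / m%:R)); first by rewrite ler_wpM2r// invr_ge0 ltW.
  by rewrite -mulrA mulrCA ler_wpM2l.
(* The markers contribute at most [|E| h s / 2], half of the saving [|E| h s]. *)
have : 0 < #|` E|%:R * (h * s) by rewrite mulr_gt0.
lra.
Qed.
End erasure_strict.

(** * Isolated shifts under an entropy bound *)

Theorem corollary1p9 (R : realType) (G : groupType) (S : {fset G})
  (A : finType) (F : shift_class G) (c : R)
  (hcount : countable [set: G]) (hinf : infinite_set [set: G])
  (hS : generating S) (hG : amenable R S)
  (hF : strongly_stable S F) (hc : 0 <= c) :
  forall X : subshift G A,
    isolated (shifts_ge S F A c) X -> entropy R S X = c%:E.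
Proof.
move=> X [/set_mem[FX cX] [W /shift_nbhsP[K KW] WX]].
(* The empty shift has entropy [-oo], below the real number [c]. *)
have X0 : (X : set (config G A)) !=set0.
  apply/set0P/negP => /eqP X0; move: cX.
  by rewrite (entropy_set0 hG X0).
rewrite (entropyE hS X0 hG) in cX *.
set h := entropy_inf R X in cX *.
apply: contrapT => hnc.
have ch : c < h.
  move: cX; rewrite lee_fin le_eqVlt => /orP[/eqP ch|//].
  by case: hnc; rewrite ch.
have h0 : 0 < h by exact: le_lt_trans ch.
pose a : R := ln #|A|%:R.
have [x0 Xx0] := X0.
have a0 : 0 <= a by rewrite ln_ge0// ler1n; apply/card_gt0P; exists (x0 1%g).
(* The first summand preserves the [K]-patterns, the second keeps the entropy loss within
   [h - c]. *)
pose M := (3 * #|` K| + Num.bound (3 * a / (h - c))).+1.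
have aM : 3 / M%:R * a <= h - c.
  have hc0 : 0 < h - c by rewrite subr_gt0.
  rewrite mulrAC ler_pdivrMr ?ltr0n// [leRHS]mulrC -ler_pdivrMr//; apply/ltW.
  apply: lt_le_trans (archi_boundP _) _; first by rewrite divr_ge0 ?mulr_ge0// ltW.
  by rewrite ler_nat leqW// leq_addl.
pose B := (1%g |` fmul (fsinv K) K)%fset.
have B1 : 1%g \in B by rewrite fset1U1.
have [F0 [V [V0 cV VF ZX]]] := erased_shift_neq hS hG hinf B1 (ltn0Sn _ : (0 < M)%N) X0 h0.
pose Z := erased_shift X (marker_shift V) F0 x0 B1.
have KB k l : k \in K -> l \in K -> (k^-1 * l)%g \in B.
  by move=> kK lK; apply/fset1Ur/mem_fmul => //; rewrite in_fsinv invgK.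
(* This intersection is the singleton of [X], whereas [Z] differs from [X]. *)
have : (W `&` shifts_ge S F A c) Z.
  split.
    apply: KW; apply/esym; apply: (erased_patterns X x0 hS hG V0 B1 cV) => //.
    by rewrite /M ltnS leq_addr.
  split.
    have [factor_stable product_stable] := hF.
    apply: (factor_stable _ _ (prod_shift X (marker_shift V))).
      by apply: product_stable => //; exact: marker_strongly_irreducible.
    exact: erased_factor.
  have Z0 : (Z : set (config G A)) !=set0 by exact: erased_shift_neq0.
  rewrite (entropyE hS Z0 hG) lee_fin.
  have := erased_entropy_ge hS hG V0 B1 cV Xx0.
  rewrite -/h -/Z -/a; lra.
by rewrite WX => /(ZX x0 Xx0).
Qed.
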